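(* Let $(\mathbb E;Q,B;M)$ be a VB-Courant algebroid and $D\subseteq\mathbb E$ a maximal isotropic double vector subbundle with sides $U\subseteq Q$ and $B'\subseteq B$. Choose a Lagrangian splitting of $\mathbb E$ that is adapted to $D$ and consider the corresponding Dorfman $2$-representation $(\partial_B,\Delta,\nabla,R)$ of $(Q,\rho_Q)$, with dual dull bracket $[\![\cdot,\cdot]\!]$ on $\Gamma(Q)$. Then $D$ is a Dirac structure in $\mathbb E$ with support $B'$ if and only if 1. $\partial_B(U^\circ)\subseteq B'$, 2. $\nabla_ub\in\Gamma(B')$ for all $u\in\Gamma(U)$ and $b\in\Gamma(B')$, 3. $[\![u_1,u_2]\!]\in\Gamma(U)$ for all $u_1,u_2\in\Gamma(U)$, 4. $R(u_1,u_2)$ restricts to a section of $\mathrm{Hom}(B',U^\circ)$ for all $u_1,u_2\in\Gamma(U)$.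
   Context: $U^\circ\subseteq Q^*$ is the annihilator of $U$. **Courant algebroid** $\mathsf E\to N$: nondegenerate symmetric pairing, anchor $\rho$, $\mathbb R$-bilinear bracket with $[\![e_1,[\![e_2,e_3]\!]]\!]=[\![[\![e_1,e_2]\!],e_3]\!]+[\![e_2,[\![e_1,e_3]\!]]\!]$, $\rho(e_1)\langle e_2,e_3\rangle=\langle[\![e_1,e_2]\!],e_3\rangle+\langle e_2,[\![e_1,e_3]\!]\rangle$, $[\![e_1,e_2]\!]+[\![e_2,e_1]\!]=\mathcal D\langle e_1,e_2\rangle$, $\langle\mathcal Df,e\rangle=\rho(e)f$. A Dirac structure with support $S$ is a subbundle $D\to S$ of $\mathsf E$ over a submanifold $S\subseteq N$ such that $D(s)$ is maximal isotropic in $\mathsf E(s)$ for $s\in S$ and $e_1|_S,e_2|_S\in\Gamma_S(D)$ implies $[\![e_1,e_2]\!]|_S\in\Gamma_S(D)$ for $e_i\in\Gamma(\mathsf E)$. **Double vector bundles.** $(\mathbb E;Q,B;M)$: commutative square of vector bundles $\pi_Q:\mathbb E\to Q$, $\pi_B:\mathbb E\to B$, $Q\to M$, $q_B:B\to M$ such that the structure maps of $\mathbb E\to B$ are vector bundle morphisms over those of $Q\to M$; core $C=\ker\pi_Q\cap\ker\pi_B$. Core sections of $\mathbb E\to B$: $c^\dagger(b_m)=0_{b_m}+_Q\overline{c(m)}$, $c\in\Gamma(C)$; linear sections: sections that are vector bundle morphisms $(B\to M)\to(\mathbb E\to Q)$ over some $q\in\Gamma(Q)$; for $\phi\in\Gamma(\mathrm{Hom}(B,C))$,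 $\widetilde\phi(b_m)=0_{b_m}+_Q\overline{\phi(b_m)}$. Linear splitting $\Sigma:Q\times_MB\to\mathbb E$: injective double vector bundle morphism over the identities on the sides; $\sigma_Q(q)(b_m)=\Sigma(q(m),b_m)$. Metric double vector bundle: symmetric nondegenerate pairing on $\mathbb E\to B$ inducing an isomorphism of double vector bundles $\mathbb E\to\mathbb E^*_B$ (dual over $B$); core identified with $Q^*$. Lagrangian splitting: image maximal isotropic in $\mathbb E\to B$. Let $D\subseteq\mathbb E$ be a double vector subbundle over the sides $B'\subseteq B$, $U\subseteq Q$. It is maximal isotropic if its fibres over points of $B'$ are maximal isotropic in those of $\mathbb E\to B$; its core is then $U^\circ$. A splitting is adapted to $D$ if $\Sigma(U\times_MB')\subseteq D$. **VB-Courant algebroid**: metric double vector bundle with Courant algebroid structure on $\mathbb E\to B$ (same pairing), anchor $\Theta:\mathbb E\to TB$ a double vector bundle morphism over $\rho_Q:Q\to TM$, and linear bracket (linear/linear gives linear, linear/core gives core, core/core gives $0$). A Lagrangian splitting defines the Dorfman $2$-representation $(\partial_B:Q^*\to B,\Delta,\nabla,R)$, with $\Delta:\Gamma(Q)\times\Gamma(Q^* )\to\Gamma(Q^* )$, $\nabla$ a $Q$-connection on $B$, $R\in\Omega^2(Q,\mathrm{Hom}(B,Q^* ))$, by $\Theta(\tau^\dagger)=(\partial_B\tau)^\uparrow$ (vertical lift), $\Theta(\sigma_Q(q))=\widehat{\nabla_q}$, $[\![\sigma_Q(q),\tau^\dagger]\!]=(\Delta_q\tau)^\dagger$, $[\![\sigma_Q(q_1),\sigma_Q(q_2)]\!]=\sigma_Q([\![q_1,q_2]\!])-\widetilde{R(q_1,q_2)}$,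 where $\langle[\![q_1,q_2]\!],\tau\rangle=\rho_Q(q_1)\langle q_2,\tau\rangle-\langle q_2,\Delta_{q_1}\tau\rangle$ and, for a derivation $D$ of $\Gamma(B)$ over $X\in\mathfrak X(M)$, $\widehat D\in\mathfrak X(B)$ satisfies $\widehat D(q_B^*f)=q_B^*(Xf)$, $\widehat D(\ell_\beta)=\ell_{D^*\beta}$ for $\beta\in\Gamma(B^* )$ ($\ell_\beta$ the associated linear function). *)

(* Defs.v *)
From HB Require Import structures.
From mathcomp Require Import all_boot all_order all_algebra.
From mathcomp Require Import all_classical all_reals all_analysis.
Set Implicit Arguments.
Unset Strict Implicit.
Unset Printing Implicit Defensive.
Import Order.TTheory GRing.Theory Num.Theory.
Import numFieldNormedType.Exports.
Local Open Scope classical_set_scope.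
Local Open Scope ring_scope.

(** * Smooth manifolds *)

Fixpoint Ck (R : realType) (V W : normedModType R) (k : nat) (A : set V)
    (f : V -> W) : Prop :=
  if k is k'.+1 then
    (forall x, A x -> differentiable f x) /\ (forall v, Ck k' A (derive f ^~ v))
  else forall x, A x -> {for x, continuous f}.

Definition smooth_on (R : realType) (V W : normedModType R) (A : set V)
  (f : V -> W) : Prop := forall k, Ck k A f.

(* [cmap] and [cinv] are total functions; only their values on [cdom] and on
   its image matter. *)
Record chart (R : realType) (N : topologicalType) (n : nat) := Chart {
  cdom : set N;
  cmap : N -> 'rV[R]_n;
  cinv : 'rV[R]_n -> N;
  cdom_open : open cdom;
  cimg_open : open (cmap @` cdom);
  cmapK : forall x, cdom x -> cinv (cmap x) = x;
  cmap_cont : forall x, cdom x -> {for x, continuous cmap};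
  cinv_cont : forall y, (cmap @` cdom) y -> {for y, continuous cinv}
}.

Definition compatible (R : realType) (N : topologicalType) (n k : nat)
    (c : chart R N n) (d : chart R N k) : Prop :=
  smooth_on (cmap c @` (cdom c `&` cdom d)) (cmap d \o cinv c) /\
  smooth_on (cmap d @` (cdom c `&` cdom d)) (cmap c \o cinv d).

(* The smooth structure is a maximal atlas.  Dimensions of manifolds, and ranks
   of vector bundles below, are only required to be locally constant. *)
Record manifold (R : realType) := Manifold {
  mcarrier :> topologicalType;
  m_hausdorff : hausdorff_space mcarrier;
  m_second_countable : @second_countable mcarrier;
  atlas : forall n, set (chart R mcarrier n);
  atlas_cover : forall x, exists n (c : chart R mcarrier n),
    atlas c /\ cdom c x;
  atlas_compatible : forall n k (c : chart R mcarrier n) (d : chart R mcarrier k),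
    atlas c -> atlas d -> compatible c d;
  atlas_maximal : forall n (c : chart R mcarrier n),
    (forall k (d : chart R mcarrier k), atlas d -> compatible c d) -> atlas c
}.

Section Manifolds.
Context {R : realType}.
Implicit Types N P : manifold R.

Definition smooth_fun N (f : N -> R) : Prop :=
  forall n (c : chart R N n), atlas c ->
    smooth_on (cmap c @` cdom c) (f \o cinv c).

Definition smooth_map N P (f : N -> P) : Prop :=
  continuous f /\
  forall n (c : chart R N n) k (d : chart R P k), atlas c -> atlas d ->
    smooth_on (cmap c @` (cdom c `&` f @^-1` cdom d)) (cmap d \o f \o cinv c).

Definition smooth_curve N (c : R -> N) : Prop :=
  continuous c /\
  forall n (d : chart R N n), atlas d ->
    smooth_on (c @^-1` cdom d) (cmap d \o c).

Definition submanifold N (S : set N) : Prop :=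
  forall x, S x -> exists n (c : chart R N n) (r : nat),
    [/\ atlas c, cdom c x &
     forall y, cdom c y ->
       (S y <-> forall i : 'I_n, (r <= i)%N -> cmap c y 0 i = 0)].

(* Tangent vectors at [x] are derivations at [x] of the smooth functions on [N].
   A map [v] is defined on all functions, but only its values on smooth ones
   are ever used, and equality of tangent vectors is [tangent_eq]. *)
Definition is_tangent N (x : N) (v : (N -> R) -> R) : Prop :=
  (forall (a : R) f g, smooth_fun f -> smooth_fun g ->
     v (fun y => a * f y + g y) = a * v f + v g) /\
  (forall f g, smooth_fun f -> smooth_fun g ->
     v (fun y => f y * g y) = f x * v g + g x * v f).

Definition tangent_eq N (v w : (N -> R) -> R) : Prop :=
  forall f, smooth_fun f -> v f = w f.

Definition pushforward N P (F : N -> P) (v : (N -> R) -> R) : (P -> R) -> R :=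
  fun f => v (f \o F).

Definition velocity N (c : R -> N) (v : (N -> R) -> R) : Prop :=
  smooth_curve c /\
  forall f, smooth_fun f -> is_derive (0 : R) (1 : R) (f \o c) (v f).

End Manifolds.

(** * Vector bundles *)

(* A vector bundle chart is a manifold chart d of the total space E, of the form
   e |-> (x, T e) with x the coordinates of the base point in a chart c, and T a
   linear bijection from each fibre over the domain of c to R^k. *)
Definition vb_chart (R : realType) (E M : manifold R) (proj : E -> M)
    (add : E -> E -> E) (scale : R -> E -> E) (zero : M -> E) (n k : nat)
    (c : chart R M n) (d : chart R E (n + k)) (T : E -> 'rV[R]_k) : Prop :=
  [/\ [/\ atlas c, atlas d & cdom d = proj @^-1` cdom c],
      forall e, cdom d e -> cmap d e = row_mx (cmap c (proj e)) (T e),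
      forall x t, cdom c x -> exists! e, proj e = x /\ T e = t &
      [/\ forall e e', cdom d e -> proj e = proj e' ->
            T (add e e') = T e + T e',
          forall a e, cdom d e -> T (scale a e) = a *: T e &
          forall x, cdom c x -> T (zero x) = 0]].

(* [vadd] is meaningful on pairs in a common fibre.  The vector space axioms in
   the fibres and the smoothness of the operations follow from [vlocal]. *)
Record vbundle (R : realType) (E M : manifold R) := VBundle {
  vproj : E -> M;
  vadd : E -> E -> E;
  vscale : R -> E -> E;
  vzero : M -> E;
  vproj_smooth : smooth_map vproj;
  vproj_add : forall e e', vproj e = vproj e' -> vproj (vadd e e') = vproj e;
  vproj_scale : forall a e, vproj (vscale a e) = vproj e;
  vproj_zero : forall m, vproj (vzero m) = m;
  vlocal : forall m, exists n k (c : chart R M n) (d : chart R E (n + k))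
      (T : E -> 'rV[R]_k),
    vb_chart vproj vadd vscale vzero c d T /\ cdom c m
}.

Section VectorBundles.
Context {R : realType}.

Definition section (E M : manifold R) (V : vbundle E M) (s : M -> E) : Prop :=
  smooth_map s /\ forall m, vproj V (s m) = m.

(* Vector bundle morphism F over f. *)
Definition vb_morphism (E M E' M' : manifold R) (V : vbundle E M)
    (V' : vbundle E' M') (f : M -> M') (F : E -> E') : Prop :=
  [/\ smooth_map f, smooth_map F,
      forall e, vproj V' (F e) = f (vproj V e),
      forall e e', vproj V e = vproj V e' ->
        F (vadd V e e') = vadd V' (F e) (F e') &
      forall a e, F (vscale V a e) = vscale V' a (F e)].

(* Smooth functions on E that are linear on fibres: these are the functions
   l_beta, for beta a section of the dual bundle. *)
Definition linear_fun (E M : manifold R) (V : vbundle E M) (l : E -> R) : Prop :=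
  [/\ smooth_fun l,
      forall e e', vproj V e = vproj V e' -> l (vadd V e e') = l e + l e' &
      forall a e, l (vscale V a e) = a * l e].

Definition fibre_subspace (E M : manifold R) (V : vbundle E M) (m : M)
    (W : set E) : Prop :=
  [/\ forall e, W e -> vproj V e = m, W (vzero V m),
      forall e e', W e -> W e' -> W (vadd V e e') &
      forall a e, W e -> W (vscale V a e)].

(* D is a vector subbundle of E over the submanifold S of M: around every point
   of S there is a vector bundle chart of E in which D is R^r x {0} over S. *)
Definition subbundle (E M : manifold R) (V : vbundle E M) (S : set M)
    (D : set E) : Prop :=
  [/\ submanifold S,
      forall e, D e -> S (vproj V e) &
      forall m, S m -> exists n k (c : chart R M n) (d : chart R E (n + k))
          (T : E -> 'rV[R]_k) (r : nat),
        [/\ vb_chart (vproj V) (vadd V) (vscale V) (vzero V) c d T, cdom c m &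
            forall e, cdom d e -> S (vproj V e) ->
              (D e <-> forall i : 'I_k, (r <= i)%N -> T e 0 i = 0)]].

(* Vector bundle morphism E -> TN over f : M -> N.  Smoothness of a map v into TN
   over a smooth f means that e |-> v(e)g is smooth for all smooth g. *)
Definition vb_morphism_tangent (E M N : manifold R) (V : vbundle E M)
    (f : M -> N) (v : E -> (N -> R) -> R) : Prop :=
  [/\ smooth_map f,
      forall e, is_tangent (f (vproj V e)) (v e),
      forall g, smooth_fun g -> smooth_fun (fun e => v e g),
      forall e e', vproj V e = vproj V e' ->
        tangent_eq (v (vadd V e e')) (fun g => v e g + v e' g) &
      forall a e, tangent_eq (v (vscale V a e)) (fun g => a * v e g)].

(* Smoothness of a map on the fibre product of V1 and V2 over M, through the
   universal property of the fibre product. *)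
Definition smooth_fun_fibre (E1 E2 M : manifold R) (V1 : vbundle E1 M)
    (V2 : vbundle E2 M) (F : E1 -> E2 -> R) : Prop :=
  forall (P : manifold R) (f : P -> E1) (g : P -> E2),
    smooth_map f -> smooth_map g ->
    (forall p, vproj V1 (f p) = vproj V2 (g p)) ->
    smooth_fun (fun p => F (f p) (g p)).

Definition smooth_map_fibre (E1 E2 M E : manifold R) (V1 : vbundle E1 M)
    (V2 : vbundle E2 M) (F : E1 -> E2 -> E) : Prop :=
  forall (P : manifold R) (f : P -> E1) (g : P -> E2),
    smooth_map f -> smooth_map g ->
    (forall p, vproj V1 (f p) = vproj V2 (g p)) ->
    smooth_map (fun p => F (f p) (g p)).

(* Addition and scalar multiplication of the tangent prolongation TE -> TM of a
   vector bundle E -> M, i.e. the tangent maps of those of E -> M. *)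
Definition prolonged_add (E M : manifold R) (V : vbundle E M)
    (v1 v2 v : (E -> R) -> R) : Prop :=
  exists c1 c2 : R -> E,
    [/\ forall t, vproj V (c1 t) = vproj V (c2 t),
        velocity c1 v1, velocity c2 v2 &
        velocity (fun t => vadd V (c1 t) (c2 t)) v].

Definition prolonged_scale (E M : manifold R) (V : vbundle E M) (a : R)
    (v : (E -> R) -> R) : (E -> R) -> R := pushforward (vscale V a) v.

(* v is the value at x of the vertical lift of a section with value y at the
   base point of x. *)
Definition is_vertical_lift (E M : manifold R) (V : vbundle E M) (y x : E)
    (v : (E -> R) -> R) : Prop :=
  velocity (fun t : R => vadd V x (vscale V t y)) v.

End VectorBundles.

(** * Courant algebroids *)

(* Only the values of the bracket on smooth sections, and of [cD] on smooth
   functions, are relevant. *)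
Record courant (R : realType) (E N : manifold R) (V : vbundle E N) := Courant {
  cpair : E -> E -> R;
  canchor : E -> (N -> R) -> R;
  cbracket : (N -> E) -> (N -> E) -> N -> E;
  cD : (N -> R) -> N -> E;
  cpair_smooth : smooth_fun_fibre V V cpair;
  cpair_sym : forall e e', vproj V e = vproj V e' -> cpair e e' = cpair e' e;
  cpairD : forall e1 e2 e', vproj V e1 = vproj V e2 -> vproj V e1 = vproj V e' ->
    cpair (vadd V e1 e2) e' = cpair e1 e' + cpair e2 e';
  cpairZ : forall a e e', vproj V e = vproj V e' ->
    cpair (vscale V a e) e' = a * cpair e e';
  cpair_nondegenerate : forall e,
    (forall e', vproj V e = vproj V e' -> cpair e e' = 0) ->
    e = vzero V (vproj V e);
  canchor_morphism : vb_morphism_tangent V id canchor;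
  cbracket_section : forall e1 e2, section V e1 -> section V e2 ->
    section V (cbracket e1 e2);
  cbracketDl : forall e1 e1' e2,
    section V e1 -> section V e1' -> section V e2 ->
    forall x, cbracket (fun y => vadd V (e1 y) (e1' y)) e2 x =
      vadd V (cbracket e1 e2 x) (cbracket e1' e2 x);
  cbracketDr : forall e1 e2 e2',
    section V e1 -> section V e2 -> section V e2' ->
    forall x, cbracket e1 (fun y => vadd V (e2 y) (e2' y)) x =
      vadd V (cbracket e1 e2 x) (cbracket e1 e2' x);
  cbracketZl : forall a e1 e2, section V e1 -> section V e2 ->
    forall x, cbracket (fun y => vscale V a (e1 y)) e2 x =
      vscale V a (cbracket e1 e2 x);
  cbracketZr : forall a e1 e2, section V e1 -> section V e2 ->
    forall x, cbracket e1 (fun y => vscale V a (e2 y)) x =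
      vscale V a (cbracket e1 e2 x);
  cbracket_jacobi : forall e1 e2 e3,
    section V e1 -> section V e2 -> section V e3 ->
    forall x, cbracket e1 (cbracket e2 e3) x =
      vadd V (cbracket (cbracket e1 e2) e3 x) (cbracket e2 (cbracket e1 e3) x);
  cbracket_invariant : forall e1 e2 e3,
    section V e1 -> section V e2 -> section V e3 ->
    forall x, canchor (e1 x) (fun y => cpair (e2 y) (e3 y)) =
      cpair (cbracket e1 e2 x) (e3 x) + cpair (e2 x) (cbracket e1 e3 x);
  cbracket_sym : forall e1 e2, section V e1 -> section V e2 ->
    forall x, vadd V (cbracket e1 e2 x) (cbracket e2 e1 x) =
      cD (fun y => cpair (e1 y) (e2 y)) x;
  cD_section : forall f, smooth_fun f -> section V (cD f);
  cD_pair : forall f, smooth_fun f -> forall e,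
    cpair (cD f (vproj V e)) e = canchor e f
}.

Section Dirac.
Context {R : realType} {E N : manifold R} {V : vbundle E N}.
Variable K : courant V.

Definition isotropic (W : set E) : Prop :=
  forall e e', W e -> W e' -> cpair K e e' = 0.

Definition maximal_isotropic_fibre (x : N) (W : set E) : Prop :=
  [/\ fibre_subspace V x W, isotropic W &
      forall W', fibre_subspace V x W' -> isotropic W' -> W `<=` W' ->
        W' `<=` W].

Definition maximal_isotropic (S : set N) (D : set E) : Prop :=
  forall x, S x -> maximal_isotropic_fibre x (D `&` [set e | vproj V e = x]).

Definition dirac_with_support (S : set N) (D : set E) : Prop :=
  [/\ submanifold S, subbundle V S D, maximal_isotropic S D &
      forall e1 e2, section V e1 -> section V e2 ->
        (forall s, S s -> D (e1 s)) -> (forall s, S s -> D (e2 s)) ->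
        forall s, S s -> D (cbracket K e1 e2 s)].

End Dirac.

(** * Double vector bundles *)

(* Notation in the field names: EQ, EB, QM, BM are the bundles E -> Q, E -> B,
   Q -> M and B -> M. *)
Record dvb (R : realType) (E Q B M : manifold R) := DVB {
  EQ : vbundle E Q;
  EB : vbundle E B;
  QM : vbundle Q M;
  BM : vbundle B M;
  dvb_square : forall e, vproj QM (vproj EQ e) = vproj BM (vproj EB e);
  dvb_proj : vb_morphism EQ BM (vproj QM) (vproj EB);
  dvb_zero : vb_morphism BM EQ (vzero QM) (vzero EB);
  dvb_add_proj : forall e e', vproj EB e = vproj EB e' ->
    vproj EQ (vadd EB e e') = vadd QM (vproj EQ e) (vproj EQ e');
  dvb_add_add : forall e1 e2 e3 e4,
    vproj EB e1 = vproj EB e2 -> vproj EB e3 = vproj EB e4 ->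
    vproj EQ e1 = vproj EQ e3 -> vproj EQ e2 = vproj EQ e4 ->
    vadd EQ (vadd EB e1 e2) (vadd EB e3 e4) =
    vadd EB (vadd EQ e1 e3) (vadd EQ e2 e4);
  dvb_add_scale : forall a e e', vproj EB e = vproj EB e' ->
    vscale EQ a (vadd EB e e') = vadd EB (vscale EQ a e) (vscale EQ a e');
  dvb_scale : forall a, vb_morphism EQ EQ (vscale QM a) (vscale EB a)
}.

Section DVBTheory.
Context {R : realType} {E Q B M : manifold R}.
Variable V : dvb E Q B M.

Definition core (m : M) (c : E) : Prop :=
  vproj (EQ V) c = vzero (QM V) m /\ vproj (EB V) c = vzero (BM V) m.

(* Sections of the core, as maps into E. *)
Definition section_core (c : M -> E) : Prop :=
  smooth_map c /\ forall m, core m (c m).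

(* c^dagger *)
Definition dagger (c : M -> E) (b : B) : E :=
  vadd (EQ V) (vzero (EB V) b) (c (vproj (BM V) b)).

Definition core_section (chi : B -> E) : Prop :=
  exists2 c, section_core c & chi =1 dagger c.

Definition linear_section (chi : B -> E) : Prop :=
  section (EB V) chi /\
  exists2 q, section (QM V) q & vb_morphism (BM V) (EQ V) q chi.

(* phi~ for phi : B -> E with values in the core *)
Definition phi_tilde (phi : B -> E) (b : B) : E :=
  vadd (EQ V) (vzero (EB V) b) (phi b).

(* Sections of Hom(B, C).  On the core, the additions over Q and over B agree,
   and so do the scalar multiplications. *)
Definition section_hom (phi : B -> E) : Prop :=
  [/\ smooth_map phi, forall b, core (vproj (BM V) b) (phi b),
      forall b b', vproj (BM V) b = vproj (BM V) b' ->
        phi (vadd (BM V) b b') = vadd (EB V) (phi b) (phi b') &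
      forall a b, phi (vscale (BM V) a b) = vscale (EB V) a (phi b)].

Definition dv_subbundle (D : set E) (U : set Q) (B' : set B) : Prop :=
  [/\ subbundle (QM V) setT U, subbundle (BM V) setT B',
      subbundle (EB V) B' D & subbundle (EQ V) U D].

(* Linear splitting of V: a double vector bundle morphism over the identities on
   Q and B (in particular injective).  Sigma q b is meaningful if q and b lie
   over the same point of M. *)
Definition linear_splitting (Sigma : Q -> B -> E) : Prop :=
  [/\ smooth_map_fibre (QM V) (BM V) Sigma,
      forall q b, vproj (QM V) q = vproj (BM V) b ->
        vproj (EQ V) (Sigma q b) = q /\ vproj (EB V) (Sigma q b) = b,
      forall q q' b, vproj (QM V) q = vproj (BM V) b ->
        vproj (QM V) q' = vproj (BM V) b ->
        Sigma (vadd (QM V) q q') b = vadd (EB V) (Sigma q b) (Sigma q' b),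
      forall q b b', vproj (QM V) q = vproj (BM V) b ->
        vproj (QM V) q = vproj (BM V) b' ->
        Sigma q (vadd (BM V) b b') = vadd (EQ V) (Sigma q b) (Sigma q b') &
      forall a q b, vproj (QM V) q = vproj (BM V) b ->
        Sigma (vscale (QM V) a q) b = vscale (EB V) a (Sigma q b) /\
        Sigma q (vscale (BM V) a b) = vscale (EQ V) a (Sigma q b)].

Definition sigmaQ (Sigma : Q -> B -> E) (q : M -> Q) (b : B) : E :=
  Sigma (q (vproj (BM V) b)) b.

Definition adapted (Sigma : Q -> B -> E) (D : set E) (U : set Q) (B' : set B) :
    Prop :=
  forall q b, vproj (QM V) q = vproj (BM V) b -> U q -> B' b -> D (Sigma q b).

End DVBTheory.

(** * VB-Courant algebroids *)

Section VBCourant.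
Context {R : realType} {E Q B M : manifold R}.
Variables (V : dvb E Q B M) (K : courant (EB V)).

(* The core C of a metric double vector bundle is identified with Q^* by
   <q, c> = <0_q, c>, where 0_q is the zero of E -> Q over q.  Accordingly,
   sections of Q^* are represented below by sections of the core. *)
Definition qpair (q : Q) (c : E) : R := cpair K (vzero (EQ V) q) c.

Definition annihilator (U : set Q) (m : M) (c : E) : Prop :=
  core V m c /\ forall u, U u -> vproj (QM V) u = m -> qpair u c = 0.

(* The isomorphism e |-> <e, .> from E to the dual of E over B is a double vector
   bundle morphism.  The dual is a double vector bundle with sides B and C^*:
   the projection p of Phi in (E_b)^* to C^* is given by
   <p(Phi), c> = Phi(0_b +_Q c), and its operations over C^* by
   (Phi1 + Phi2)(e1 +_Q e2) = Phi1(e1) + Phi2(e2) and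
   (a . Phi)(a ._Q e) = a Phi(e). *)
Definition metric_dvb : Prop :=
  [/\ forall e c, core V (vproj (BM V) (vproj (EB V) e)) c ->
        cpair K e (vadd (EQ V) (vzero (EB V) (vproj (EB V) e)) c) =
        qpair (vproj (EQ V) e) c,
      forall e1 e2 e1' e2',
        vproj (EB V) e1 = vproj (EB V) e1' ->
        vproj (EB V) e2 = vproj (EB V) e2' ->
        vproj (EQ V) e1 = vproj (EQ V) e2 ->
        vproj (EQ V) e1' = vproj (EQ V) e2' ->
        cpair K (vadd (EQ V) e1 e2) (vadd (EQ V) e1' e2') =
        cpair K e1 e1' + cpair K e2 e2' &
      forall a e e', vproj (EB V) e = vproj (EB V) e' ->
        cpair K (vscale (EQ V) a e) (vscale (EQ V) a e') = a * cpair K e e'].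

(* The anchor is a double vector bundle morphism from (E; Q, B; M) to
   (TB; TM, B; M) over rhoQ : Q -> TM and the identity on B. *)
Definition anchor_dvb_morphism (rhoQ : Q -> (M -> R) -> R) : Prop :=
  [/\ vb_morphism_tangent (QM V) id rhoQ,
      forall e, tangent_eq (pushforward (vproj (BM V)) (canchor K e))
        (rhoQ (vproj (EQ V) e)),
      forall e e', vproj (EQ V) e = vproj (EQ V) e' ->
        prolonged_add (BM V) (canchor K e) (canchor K e')
          (canchor K (vadd (EQ V) e e')) &
      forall a e, tangent_eq (canchor K (vscale (EQ V) a e))
        (prolonged_scale (BM V) a (canchor K e))].

Definition linear_bracket : Prop :=
  [/\ forall chi1 chi2, linear_section V chi1 -> linear_section V chi2 ->
        linear_section V (cbracket K chi1 chi2),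
      forall chi1 chi2, linear_section V chi1 -> core_section V chi2 ->
        core_section V (cbracket K chi1 chi2) &
      forall chi1 chi2, core_section V chi1 -> core_section V chi2 ->
        forall b, cbracket K chi1 chi2 b = vzero (EB V) b].

Definition vb_courant (rhoQ : Q -> (M -> R) -> R) : Prop :=
  [/\ metric_dvb, anchor_dvb_morphism rhoQ & linear_bracket].

Definition lagrangian_splitting (Sigma : Q -> B -> E) : Prop :=
  linear_splitting V Sigma /\
  maximal_isotropic K setT
    [set e | exists q b, vproj (QM V) q = vproj (BM V) b /\ e = Sigma q b].

(* X is the vector field on B defined by the derivation D of sections of B over
   the vector field x on M: X(q_B^* f) = q_B^* (x f) and X(l_beta) = l_{D^* beta},
   where D^* is the dual derivation, <D^* beta, b> = x <beta, b> - <beta, D b>. *)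
Definition is_hat (x : M -> (M -> R) -> R) (D : (M -> B) -> M -> B)
    (X : B -> (B -> R) -> R) : Prop :=
  (forall f, smooth_fun f ->
     forall b, X b (f \o vproj (BM V)) = x (vproj (BM V) b) f) /\
  (forall l, linear_fun (BM V) l ->
     forall b, section (BM V) b -> forall m,
       X (b m) l = x m (l \o b) - l (D b m)).

Definition is_connection (rhoQ : Q -> (M -> R) -> R)
    (nabla : (M -> Q) -> (M -> B) -> M -> B) : Prop :=
  [/\ forall q b, section (QM V) q -> section (BM V) b ->
        section (BM V) (nabla q b),
      forall q q' b,
        section (QM V) q -> section (QM V) q' -> section (BM V) b ->
        forall m, nabla (fun y => vadd (QM V) (q y) (q' y)) b m =
          vadd (BM V) (nabla q b m) (nabla q' b m),
      forall f q b, smooth_fun f -> section (QM V) q -> section (BM V) b ->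
        forall m, nabla (fun y => vscale (QM V) (f y) (q y)) b m =
          vscale (BM V) (f m) (nabla q b m),
      forall q b b',
        section (QM V) q -> section (BM V) b -> section (BM V) b' ->
        forall m, nabla q (fun y => vadd (BM V) (b y) (b' y)) m =
          vadd (BM V) (nabla q b m) (nabla q b' m) &
      forall f q b, smooth_fun f -> section (QM V) q -> section (BM V) b ->
        forall m, nabla q (fun y => vscale (BM V) (f y) (b y)) m =
          vadd (BM V) (vscale (BM V) (f m) (nabla q b m))
            (vscale (BM V) (rhoQ (q m) f) (b m))].

(* Two-forms on Q with values in Hom(B, C); Rc q1 q2 b is meaningful if q1, q2
   and b lie over the same point of M. *)
Definition is_hom_2form (Rc : Q -> Q -> B -> E) : Prop :=
  [/\ forall q1 q2, section (QM V) q1 -> section (QM V) q2 ->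
        section_hom V (fun b =>
          Rc (q1 (vproj (BM V) b)) (q2 (vproj (BM V) b)) b),
      forall q1 q1' q2 b,
        vproj (QM V) q1 = vproj (BM V) b -> vproj (QM V) q1' = vproj (BM V) b ->
        vproj (QM V) q2 = vproj (BM V) b ->
        Rc (vadd (QM V) q1 q1') q2 b = vadd (EB V) (Rc q1 q2 b) (Rc q1' q2 b),
      forall a q1 q2 b,
        vproj (QM V) q1 = vproj (BM V) b -> vproj (QM V) q2 = vproj (BM V) b ->
        Rc (vscale (QM V) a q1) q2 b = vscale (EB V) a (Rc q1 q2 b) &
      forall q1 q2 b,
        vproj (QM V) q1 = vproj (BM V) b -> vproj (QM V) q2 = vproj (BM V) b ->
        Rc q1 q2 b = vscale (EB V) (-1) (Rc q2 q1 b)].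

(* Vector bundle morphism C -> B over the identity. *)
Definition is_core_morphism (dB : E -> B) : Prop :=
  [/\ forall c, section_core V c -> section (BM V) (dB \o c),
      forall m c c', core V m c -> core V m c' ->
        dB (vadd (EB V) c c') = vadd (BM V) (dB c) (dB c') &
      forall m a c, core V m c -> dB (vscale (EB V) a c) = vscale (BM V) a (dB c)].

Definition is_dull_bracket (rhoQ : Q -> (M -> R) -> R)
    (Delta : (M -> Q) -> (M -> E) -> M -> E)
    (dull : (M -> Q) -> (M -> Q) -> M -> Q) : Prop :=
  forall q1 q2, section (QM V) q1 -> section (QM V) q2 ->
    section (QM V) (dull q1 q2) /\
    forall tau, section_core V tau -> forall m,
      qpair (dull q1 q2 m) (tau m) =
      rhoQ (q1 m) (fun y => qpair (q2 y) (tau y)) - qpair (q2 m) (Delta q1 tau m).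

(* (dB, Delta, nabla, Rc) is the Dorfman 2-representation defined by the
   splitting Sigma, and dull is its dual dull bracket. *)
Definition dorfman_2rep (rhoQ : Q -> (M -> R) -> R) (Sigma : Q -> B -> E)
    (dB : E -> B) (Delta : (M -> Q) -> (M -> E) -> M -> E)
    (nabla : (M -> Q) -> (M -> B) -> M -> B) (Rc : Q -> Q -> B -> E)
    (dull : (M -> Q) -> (M -> Q) -> M -> Q) : Prop :=
  [/\ [/\ is_core_morphism dB,
          forall q tau, section (QM V) q -> section_core V tau ->
            section_core V (Delta q tau),
          is_connection rhoQ nabla, is_hom_2form Rc &
          is_dull_bracket rhoQ Delta dull],
      forall tau, section_core V tau -> forall b,
        is_vertical_lift (BM V) (dB (tau (vproj (BM V) b))) b
          (canchor K (dagger V tau b)),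
      forall q, section (QM V) q ->
        is_hat (fun m => rhoQ (q m)) (nabla q)
          (fun b => canchor K (sigmaQ V Sigma q b)),
      forall q tau, section (QM V) q -> section_core V tau ->
        forall b, cbracket K (sigmaQ V Sigma q) (dagger V tau) b =
          dagger V (Delta q tau) b &
      forall q1 q2, section (QM V) q1 -> section (QM V) q2 ->
        forall b, cbracket K (sigmaQ V Sigma q1) (sigmaQ V Sigma q2) b =
          vadd (EB V) (sigmaQ V Sigma (dull q1 q2) b)
            (vscale (EB V) (-1)
              (phi_tilde V (fun b' =>
                 Rc (q1 (vproj (BM V) b')) (q2 (vproj (BM V) b')) b') b))].

End VBCourant.

(* Main.v *)
Require Import Defs.
From mathcomp Require Import all_boot all_order all_algebra.
From mathcomp Require Import all_classical all_reals all_analysis.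
From mathcomp Require Import ring lra.

(** Over a point b of the support, maximality forces D(b) to be the sum of
    Sigma(U, b) and the lift of U^o to b, and D(b) to be its own orthogonal.

    If D is a Dirac structure, the Leibniz rule for [[e, f e']] with f vanishing
    on B' shows that the anchor maps D into vectors tangent to B'.  Applied to
    tau^dagger and sigma_Q(u) and tested on linear functions that vanish on B',
    this gives (1) and (2); the values of [[sigma_Q(u1), sigma_Q(u2)]] in D give
    (3) and (4).

    Conversely, (1) and (2) make the anchor of D tangent to B'.  Then
    <[[e1, e2]], e3> restricted to B' is alternating in sections of D and depends
    only on their values on B', so that it suffices to check that it vanishes on
    the sections sigma_Q(u) and tau^dagger, where (3) and (4) apply.  Tangency of
    the anchor on sigma_Q(u) uses that its values are velocities of curves, by
    the definition of the addition of TB -> TM. *)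

Set Implicit Arguments.
Unset Strict Implicit.
Unset Printing Implicit Defensive.
Import Order.TTheory GRing.Theory Num.Theory.
Import numFieldNormedType.Exports.
Local Open Scope classical_set_scope.
Local Open Scope ring_scope.

(** * Smooth functions on normed spaces *)

Section Germs.
Context {R : realType} {V W : normedModType R}.

(** Two obstacles shape the proof. The vector field attached to [nabla] is prescribed only on
    pullbacks from M and on linear functions, whereas tangency to B' concerns every smooth f that
    vanishes on B'. For an abstract derivation, closing this gap would take Hadamard's lemma; for
    the velocity of a curve, the chain rule in a chart that flattens B' is enough. Moreover, tangent
    vectors act on globally defined functions, and brackets on global sections, so every coordinate
    function and every local section has to be cut off. This is why the development starts from
    exp(-1/t) and bump functions.

    Maximality of D(b) is stated by inclusion of isotropic subspaces, and no dimensions are counted: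
    an isotropic space that contains D(b) and one further vector must be D(b), so the vector was
    already there. In this way the equality of the core of D with U^o, and the inclusion of the
    double annihilator of U in U, are derived from maximality and adaptedness. *)

Lemma near0_differentiable (h : V -> W) x : 
  (\forall y \near x, h y = 0) -> differentiable h x.
Proof.
move=> h0.
have E : h \o shift x = cst (h x) + \0 +o_ (0 : V) id.
  apply/eqaddoP => e e0.
  have hx : h x = 0 by exact: nbhs_singleton h0.
  move: h0; rewrite (near_shift 0 x) subr0 => h0; near=> y.
  rewrite !fctE /= hx addr0 subr0.
  have -> : h (y + x) = 0.
    by have := near h0 y; apply.
  by rewrite normr0 mulr_ge0 // ltW.
have cz : continuous (\0 : V -> W) by move=> ?; exact: cvg_cst.
have := diff_unique cz E.
move=> D0.
apply/diff_locallyP; rewrite D0; split => //.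
Unshelve. all: by end_near.
Qed.

Lemma near_eq_differentiable (f g : V -> W) x :
  (\forall y \near x, f y = g y) -> differentiable f x -> differentiable g x.
Proof.
move=> fg df.
have -> : g = f + (g - f) by rewrite addrC subrK.
apply: differentiableD => //; apply: near0_differentiable.
near=> y; rewrite !fctE (near fg y) ?subrr//.
Unshelve. all: by end_near.
Qed.


Lemma Ck_sub k (A B : set V) (f : V -> W) : B `<=` A -> Ck k A f -> Ck k B f.
Proof.
elim: k f => [|k IH] f BA /=; first by move=> cf x /BA; exact: cf.
by move=> [df Df]; split=> [x /BA|v]; [exact: df|exact: IH].
Qed.

(** Openness of [A] turns equality on [A] into equality of germs, and differentiability and
    directional derivatives depend only on germs. *)
Lemma Ck_ext k (A : set V) (f g : V -> W) : open A ->
  (forall x, A x -> f x = g x) -> Ck k A f -> Ck k A g.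
Proof.
move=> oA; elim: k f g => [|k IH] f g fg /=.
  move=> cf x Ax; rewrite /prop_for /continuous_at -(fg _ Ax).
  apply: cvg_trans (cf x Ax); apply: near_eq_cvg.
  by apply: filterS (open_nbhs_nbhs (conj oA Ax)) => y /fg.
move=> [df Df]; split=> [x Ax|v].
  apply: near_eq_differentiable (df x Ax).
  by apply: filterS (open_nbhs_nbhs (conj oA Ax)) => y /fg.
apply: IH (Df v) => x Ax; apply: near_eq_derive.
by apply: filterS (open_nbhs_nbhs (conj oA Ax)) => y /fg.
Qed.

Lemma CkS k (A : set V) (f : V -> W) : Ck k.+1 A f -> Ck k A f.
Proof.
elim: k f => [|k IH] f [df Df].
  by move=> x /df /differentiable_continuous.
by split=> // v; apply: IH.
Qed.

Lemma Ck_cst k (A : set V) (a : W) : Ck k A (cst a).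
Proof.
elim: k a => [|k IH] a /=; first by move=> x _; exact: cvg_cst.
split=> [x _|v]; first exact: differentiable_cst.
rewrite (_ : 'D_v _ = cst 0) //; apply/funext => x.
by rewrite derive_cst.
Qed.

Lemma CkD k (A : set V) (f g : V -> W) : open A ->
  Ck k A f -> Ck k A g -> Ck k A (fun x => f x + g x).
Proof.
move=> oA; elim: k f g => [|k IH] f g /=.
  by move=> cf cg x Ax; apply: cvgD; [exact: cf|exact: cg].
move=> [df Df] [dg Dg]; split=> [x Ax|v].
  by apply: differentiableD; [exact: df|exact: dg].
apply: Ck_ext (IH _ _ (Df v) (Dg v)) => // x Ax.
by rewrite deriveD //; apply: diff_derivable; [exact: df|exact: dg].
Qed.

Lemma Ck_sum k (A : set V) (I : Type) (r : seq I) (f : I -> V -> W) : open A ->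
  (forall i, Ck k A (f i)) -> Ck k A (fun x => \sum_(i <- r) f i x).
Proof.
move=> oA Cf; elim: r => [|i r IH].
  by under eq_fun do rewrite big_nil; exact: Ck_cst.
by under eq_fun do rewrite big_cons; apply: CkD.
Qed.

End Germs.

Section CkReal.
Context {R : realType} {V : normedModType R}.

Lemma CkM k (A : set V) (f g : V -> R) : open A ->
  Ck k A f -> Ck k A g -> Ck k A (fun x => f x * g x).
Proof.
move=> oA; elim: k f g => [|k IH] f g.
  by move=> cf cg x Ax; apply: cvgM; [exact: cf|exact: cg].
move=> Cf Cg; have [df Df] := Cf; have [dg Dg] := Cg; split=> [x Ax|v].
  by apply: differentiableM; [exact: df|exact: dg].
have C := CkD oA (IH _ _ (CkS Cf) (Dg v)) (IH _ _ (CkS Cg) (Df v)).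
apply: Ck_ext C => // x Ax.
by rewrite deriveM //; apply: diff_derivable; [exact: df|exact: dg].
Qed.

Lemma Ck_comp1 k (A : set V) (B : set R) (f : V -> R) (g : R -> R) :
  open A -> open B -> (forall x, A x -> B (f x)) ->
  Ck k A f -> Ck k B g -> Ck k A (g \o f).
Proof.
move=> oA oB AB; elim: k g => [|k IH] g.
  by move=> cf cg x Ax; apply: continuous_comp; [exact: cf|exact/cg/AB].
move=> Cf Cg; have [df Df] := Cf; have [dg Dg] := Cg; split=> [x Ax|v].
  by apply: differentiable_comp; [exact: df|exact/dg/AB].
have C := CkM oA (Df v) (IH _ (CkS Cf) (Dg 1)).
apply: Ck_ext C => // x Ax.
have dfx := df _ Ax; have dgx := dg _ (AB _ Ax).
rewrite [RHS]deriveE; last exact: differentiable_comp.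
by rewrite diff_comp //= (diff1E dgx) derive1E -deriveE.
Qed.

Lemma Ck_coordE k n (A : set V) (f : V -> 'rV[R]_n) i : open A ->
  Ck k A f -> Ck k A (fun x => f x 0 i).
Proof.
move=> oA; elim: k f => [|k IH] f.
  move=> cf x Ax.
  apply: (@continuous_comp _ _ _ f (fun y => y 0 i)); first exact: cf.
  exact: coord_continuous.
move=> [df Df]; split=> [x Ax|v].
  apply: (@differentiable_comp _ _ _ _ f (fun y => y 0 i)); first exact: df.
  exact: differentiable_coord.
apply: Ck_ext (IH _ (Df v)) => // x Ax.
by rewrite derive_mx ?mxE//; apply: diff_derivable; exact: df.
Qed.

Lemma Ck_coordP k n (A : set V) (f : V -> 'rV[R]_n) : open A ->
  (forall i, Ck k A (fun x => f x 0 i)) -> Ck k A f.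
Proof.
have fE (g : V -> 'rV[R]_n) : g = \sum_i (fun x => g x 0 i *: delta_mx 0 i).
  by apply/funext => x; rewrite fct_sumE {1}[g x]row_sum_delta.
move=> oA; elim: k f => [|k IH] f.
  move=> cf x Ax; rewrite [f]fE; apply: (big_ind (fun g => {for x, continuous g})).
  - exact: cvg_cst.
  - by move=> g h; exact: cvgD.
  - by move=> i _; apply: cvgZr_tmp; exact: (cf i).
move=> Cf; have df x : A x -> differentiable f x.
  move=> Ax; rewrite [f]fE; apply: differentiable_sum => i.
  by apply: differentiableZl; case: (Cf i) => + _; apply.
split=> // v; apply: IH => i; apply: Ck_ext (proj2 (Cf i) v) => // x Ax.
by rewrite derive_mx ?mxE//; apply: diff_derivable; exact: df.
Qed.

(** By the chain rule, ['D_v (g \o f)] is the sum over i of the i-th coordinate of ['D_v f] times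
    the i-th partial derivative of [g] composed with [f]. The induction is over all [g], because the
    partial derivatives take its place; [f] stays fixed and only loses a degree. *)
Lemma Ck_comp k n (A : set V) (B : set 'rV[R]_n) (f : V -> 'rV[R]_n)
    (g : 'rV[R]_n -> R) :
  open A -> open B -> (forall x, A x -> B (f x)) ->
  Ck k A f -> Ck k B g -> Ck k A (g \o f).
Proof.
move=> oA oB AB; elim: k g => [|k IH] g.
  by move=> cf cg x Ax; apply: continuous_comp; [exact: cf|exact/cg/AB].
move=> Cf Cg; have [df Df] := Cf; have [dg Dg] := Cg; split=> [x Ax|v].
  by apply: differentiable_comp; [exact: df|exact/dg/AB].
have C i := CkM oA (Ck_coordE i oA (Df v)) (IH _ (CkS Cf) (Dg (delta_mx 0 i))).
apply: Ck_ext (Ck_sum (index_enum _) oA C) => // x Ax.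
have dfx := df _ Ax; have dgx := dg _ (AB _ Ax).
rewrite [RHS]deriveE; last exact: differentiable_comp.
rewrite diff_comp //= -(deriveE v dfx) [in RHS](row_sum_delta ('D_v f x)).
rewrite linear_sum; apply: eq_bigr => i _; rewrite linearZ.
by congr (_ * _); rewrite /= deriveE.
Qed.

Lemma Ck_coord k n (A : set 'rV[R]_n) i : Ck k A (fun x : 'rV[R]_n => x 0 i).
Proof.
case: k => [|k]; first by move=> x _; exact: coord_continuous.
split=> [x _|v]; first exact: differentiable_coord.
rewrite (_ : 'D_v _ = cst (v 0 i)); first exact: Ck_cst.
apply/funext => x.
have := @derive_mx R 'rV[R]_n 1 n id x v (@derivable_id _ _ x v).
by rewrite derive_id => /matrixP /(_ 0 i); rewrite mxE.
Qed.

End CkReal.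

(** * Flat functions and bump functions on R^n *)

Section Bump.
Context {R : realType}.

(* For t > 0, the derivative of P(1/t) exp(-1/t) has the same form, so that the
   smoothness of exp(-1/t) is proved by induction for all P at once. *)
Definition flat (P : {poly R}) (t : R) : R :=
  if 0 < t then P.[t^-1] * expR (- t^-1) else 0.

Lemma flat_mulX P t : flat (P * 'X) t = t^-1 * flat P t.
Proof.
rewrite /flat; case: ifP => t0; last by rewrite mulr0.
by rewrite hornerM hornerX; ring.
Qed.

Lemma flat_cvg0 P : flat P t @[t --> 0] --> 0.
Proof.
(* All powers are treated at once, because [(P * 'X + c%:P) * 'X^n] splits into [P * 'X^(n.+1)] and
   a multiple of ['X^n]. *)
suff H n : flat (P * 'X^n) t @[t --> 0] --> 0 by have := H 0%N; rewrite mulr1.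
elim/poly_ind: P n => [|P c IH] n.
  have -> : flat (0 * 'X^n) = cst 0; last exact: cvg_cst.
  by apply/funext => t; rewrite /flat mul0r horner0 mul0r; case: ifP.
have -> : flat ((P * 'X + c%:P) * 'X^n) =
    (fun t => flat (P * 'X^(n.+1)) t + c * flat ('X^n) t).
  apply/funext => t; rewrite /flat; case: ifP => _; last by rewrite mulr0 addr0.
  by rewrite exprS !(hornerM, hornerD, hornerX, hornerXn, hornerC); ring.
suff h : flat ('X^n) t @[t --> 0] --> 0.
  by have := cvgD (IH n.+1) (@cvgMl_tmp _ _ _ _ _ c _ h); rewrite mulr0 addr0; apply.
(* From exp(s) >= s^(n+1) / (n+1)! at s = 1/t, the function is at most (n+1)! t for t > 0, whence
   the radius e / (n+1)!. *)
apply/cvgrPdist_le => e e0.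
have k0 : 0 < n.+1`!%:R :> R by rewrite ltr0n fact_gt0.
have te := @nbhs0_le R R _ (divr_gt0 e0 k0).
change (\forall t \near (0 : R), `|0 - flat ('X^n) t| <= e).
apply: filterS te => t te.
rewrite sub0r normrN /flat; case: ifP => t0; last by rewrite normr0 ltW.
rewrite hornerXn ger0_norm; last first.
  by rewrite mulr_ge0 ?expR_ge0// exprn_ge0// invr_ge0 ltW.
apply: (@le_trans _ _ (n.+1`!%:R * t)); last first.
  by rewrite mulrC -ler_pdivlMr //; apply: le_trans te; exact: ler_norm.
have := @expR_ge1Dxn R t^-1 n; rewrite invr_ge0 (ltW t0) => /(_ isT) h.
have {}h : t^-1 ^+ n.+1 <= n.+1`!%:R * expR t^-1.
  by rewrite mulrC -ler_pdivrMr //; apply: le_trans h; rewrite lerDr ler01.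
rewrite expRN ler_pdivrMr ?expR_gt0 // mulrAC -ler_pdivrMr //.
by rewrite -exprSr.
Qed.

(** With s = 1/t, the derivative of P(s) exp(-s) in t is s^2 (P(s) - P'(s)) exp(-s), which explains
    the polynomial. At 0 the difference quotient is [flat (P * 'X)], which tends to 0. *)
Lemma flat_is_derive (P : {poly R}) (t : R) :
  is_derive t (1 : R) (flat P) (flat ('X^2 * (P - P^`())) t).
Proof.
have [t0|t0|->] := ltgtP t 0.
- rewrite [X in is_derive _ _ _ X](_ : _ = 0); last by rewrite /flat ltNge (ltW t0).
  apply: (near_eq_is_derive _ (is_derive_cst (0 : R) t (1 : R))).
  near=> s; rewrite /flat ltNge ltW //.
  by near: s; exact: lt_nbhsl.
- have tn : t != 0 by rewrite gt_eqF.
  have dV : is_derive t (1 : R) (fun s : R => s^-1) (- t ^- 2).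
    apply: is_derive_eq; first exact: (is_deriveV tn (is_derive_id t (1 : R))).
    by rewrite /GRing.scale /= mulr1.
  have d1 : is_derive t (1 : R) (fun s : R => P.[s^-1]) (- t ^- 2 * P^`().[t^-1]).
    have /= := is_derive1_comp (is_derive_poly P t^-1) dV.
    by rewrite mulrC; apply.
  have d2 : is_derive t (1 : R) (fun s : R => expR (- s^-1))
      (t ^- 2 * expR (- t^-1)).
    have dN : is_derive t (1 : R) (fun s : R => - s^-1) (t ^- 2).
      by have := is_deriveN dV; rewrite opprK.
    have /= := @is_derive1_comp _ expR (fun s : R => - s^-1) _ _ _ (is_derive_expR _) dN.
    by rewrite mulrC; apply.
  have d3 := is_deriveM d1 d2.
  rewrite (_ : flat _ t = P.[t^-1] *: (t ^- 2 * expR (- t^-1)) +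
      expR (- t^-1) *: (- t ^- 2 * P^`().[t^-1])); last first.
    rewrite /flat t0 !(hornerM, hornerD, hornerN, hornerX, hornerXn) /=.
    by rewrite -exprVn /GRing.scale /=; ring.
  apply: (near_eq_is_derive _ d3).
  near=> s; rewrite /flat (_ : 0 < s) //.
  by near: s; exact: lt_nbhsr.
- have E : h^-1 *: (flat P (h *: 1 + 0) - flat P 0) @[h --> 0^'] --> 0.
    have -> : (fun h => h^-1 *: (flat P (h *: 1 + 0) - flat P 0)) = flat (P * 'X).
      apply/funext => h; rewrite flat_mulX addr0 [h *: 1]mulr1.
      by rewrite {2}/flat ltxx subr0.
    apply: cvg_trans (flat_cvg0 (P * 'X)); apply: cvg_app; exact: cvg_within.
  have -> : flat ('X^2 * (P - P^`())) 0 = 0 by rewrite /flat ltxx.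
  by apply: DeriveDef; [apply/cvg_ex; exists 0|exact: cvg_lim E].
Unshelve. all: by end_near.
Qed.

Lemma flat_Ck k P : Ck k setT (flat P).
Proof.
have df Q x : differentiable (flat Q) x.
  by apply/derivable1_diffP; case: (flat_is_derive Q x).
elim: k P => [|k IH] P; first by move=> x _; exact: differentiable_continuous.
split=> [x _|v]; first exact: df.
have -> : 'D_v (flat P) = (fun x => cst v x * flat ('X^2 * (P - P^`())) x).
  apply/funext => x; rewrite deriveE // (diff1E (df P x)) derive1E.
  by rewrite (@derive_val _ _ _ _ _ _ _ (flat_is_derive P x)).
by apply: CkM; [exact: openT|exact: Ck_cst|exact: IH].
Qed.

Lemma rV_bump n (p : 'rV[R]_n) (A : set 'rV[R]_n) : open A -> A p ->
  exists (chi : 'rV[R]_n -> R) (K : set 'rV[R]_n),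
    [/\ forall k, Ck k setT chi, chi p = 1, compact K, K `<=` A &
        forall x, ~ K x -> chi x = 0].
Proof.
move=> oA Ap.
have /nbhs_ballP[e /= e0 eA] : nbhs p A by exact: open_nbhs_nbhs.
(* Balls of the row space are cubes, and d < e puts the closed cube of half-side d inside [A].
   Outside that cube some coordinate differs from that of p by more than d, so [r] is at most 0 and
   the flat function vanishes. *)
pose d := e / 2; have d0 : 0 < d by rewrite divr_gt0.
have de : d < e by rewrite /d; lra.
pose r (x : 'rV[R]_n) := d ^+ 2 + \sum_i - ((x 0 i - p 0 i) * (x 0 i - p 0 i)).
pose chi x := flat 1 (r x) * (flat 1 (d ^+ 2))^-1.
have fd : flat 1 (d ^+ 2) != 0.
  by rewrite /flat exprn_gt0 // hornerC mul1r gt_eqF // expR_gt0.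
exists chi, [set x | forall i, `[p 0 i - d, p 0 i + d]%classic (x 0 i)]; split.
- move=> k; apply: CkM; [exact: openT| |exact: Ck_cst].
  apply: (@Ck_comp1 _ _ _ _ setT) => //; [exact: openT|exact: openT| |exact: flat_Ck].
  apply: CkD; [exact: openT|exact: Ck_cst|]; apply: Ck_sum => [|i]; first exact: openT.
  have C : Ck k setT (fun x : 'rV[R]_n => x 0 i - p 0 i).
    by apply: CkD; [exact: openT|exact: Ck_coord|exact: Ck_cst].
  under eq_fun do rewrite -mulN1r.
  apply: CkM; [exact: openT|exact: Ck_cst|].
  by apply: CkM; [exact: openT| |].
- rewrite /chi /r big1 ?addr0 ?divff // => i _.
  by rewrite subrr mul0r oppr0.
- apply: (@rV_compact R n (fun i => `[p 0 i - d, p 0 i + d]%classic)) => i.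
  exact: segment_compact.
- move=> x Kx; apply: eA; split => // i j; rewrite [i]ord1 /ball /=.
  have := Kx j; rewrite /= in_itv /= => /andP[h1 h2].
  rewrite distrC; apply: le_lt_trans de.
  by rewrite ler_norml; apply/andP; split; lra.
- move=> x /existsNP[i Ki]; rewrite /chi /flat ltNge (_ : r x <= 0) ?mul0r //.
  rewrite /r (bigD1 i) //=.
  have s0 : \sum_(j < n | j != i) - ((x 0 j - p 0 j) * (x 0 j - p 0 j)) <= 0.
    by apply: sumr_le0 => j _; rewrite oppr_le0 -expr2 sqr_ge0.
  have : d ^+ 2 <= (x 0 i - p 0 i) * (x 0 i - p 0 i).
    rewrite leNgt; apply/negP => h; apply: Ki; rewrite /= in_itv /=.
    rewrite -ler_distl -(@ler_pXn2r _ 2) ?nnegrE // ?(ltW d0)//.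
    by rewrite real_normK ?num_real // expr2 ltW.
  by move: s0; lra.
Qed.

End Bump.

(** * Manifolds *)

Section SmoothNear.
Context {R : realType}.

Lemma Ck_local (V W : normedModType R) k (B : set V) (f : V -> W) :
  (forall x, B x -> exists2 A, A x & Ck k A f) -> Ck k B f.
Proof.
elim: k f => [|k IH] f H /=.
  by move=> x /H[A Ax]; apply.
split=> [x /H[A Ax [df _]]|v]; first exact: df.
by apply: IH => x /H[A Ax [_ Df]]; exists A => //; exact: Df.
Qed.

Lemma near_open (T : topologicalType) (x : T) (P : set T) : nbhs x P ->
  exists A, [/\ open A, A x & A `<=` P].
Proof.
by move=> xP; exists P°; split; [exact: open_interior| |exact: interior_subset].
Qed.

(** [Ck k A] is a condition at each point of [A] separately, so smoothness around x can be stated on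
    singletons through the neighbourhood filter. A single neighbourhood serves all k. *)
Definition smooth_near (V W : normedModType R) (x : V) (f : V -> W) :=
  \forall y \near x, forall k, Ck k [set y] f.

Lemma smooth_nearP (V W : normedModType R) (x : V) (f : V -> W) :
  smooth_near x f <-> exists A, [/\ open A, A x & smooth_on A f].
Proof.
split=> [|[A [oA Ax sA]]].
  move=> /near_open[A [oA Ax AF]]; exists A; split => // k.
  by apply: Ck_local => y Ay; exists [set y] => //; exact: AF.
apply: filterS (open_nbhs_nbhs (conj oA Ax)) => y Ay k.
by apply: Ck_sub (sA k) => _ ->.
Qed.

Lemma smooth_near_on (V W : normedModType R) (B : set V) (f : V -> W) :
  (forall x, B x -> smooth_near x f) -> smooth_on B f.
Proof.
move=> H k; apply: Ck_local => x /H /smooth_nearP[A [_ Ax sA]].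
by exists A.
Qed.

Lemma smooth_near_eq (V W : normedModType R) (x : V) (f g : V -> W) :
  (\forall y \near x, f y = g y) -> smooth_near x f -> smooth_near x g.
Proof.
move=> /near_open[B [oB Bx fg]] /smooth_nearP[A [oA Ax sA]].
apply/smooth_nearP; exists (A `&` B); split => //; first exact: openI.
move=> k; apply: (@Ck_ext _ _ _ _ _ f); first exact: openI.
  by move=> y [_ /fg].
by apply: Ck_sub (sA k) => y [].
Qed.

Lemma smooth_near_cst (V W : normedModType R) (x : V) (a : W) :
  smooth_near x (cst a).
Proof. by apply: nearW => y k; exact: Ck_cst. Qed.

Lemma smooth_nearD (V : normedModType R) (x : V) (f g : V -> R) :
  smooth_near x f -> smooth_near x g -> smooth_near x (fun y => f y + g y).
Proof.
move=> /smooth_nearP[A [oA Ax sA]] /smooth_nearP[B [oB Bx sB]].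
apply/smooth_nearP; exists (A `&` B); split => [|//|k]; first exact: openI.
apply: CkD; first exact: openI.
  by apply: Ck_sub (sA k) => y [].
by apply: Ck_sub (sB k) => y [].
Qed.

Lemma smooth_nearM (V : normedModType R) (x : V) (f g : V -> R) :
  smooth_near x f -> smooth_near x g -> smooth_near x (fun y => f y * g y).
Proof.
move=> /smooth_nearP[A [oA Ax sA]] /smooth_nearP[B [oB Bx sB]].
apply/smooth_nearP; exists (A `&` B); split => [|//|k]; first exact: openI.
apply: CkM; first exact: openI.
  by apply: Ck_sub (sA k) => y [].
by apply: Ck_sub (sB k) => y [].
Qed.

Lemma smooth_near_coordP (V : normedModType R) n (x : V) (f : V -> 'rV[R]_n) :
  smooth_near x f <-> forall i, smooth_near x (fun y => f y 0 i).
Proof.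
split=> [/smooth_nearP[A [oA Ax sA]] i|H].
  by apply/smooth_nearP; exists A; split => // k; exact: Ck_coordE.
have : \forall y \near x, forall i k, Ck k [set y] (fun y => f y 0 i).
  exact: filter_forall.
move=> /near_open[A [oA Ax AF]]; apply/smooth_nearP; exists A; split => // k.
apply: Ck_coordP => // i; apply: Ck_local => y Ay.
by exists [set y] => //; exact: AF.
Qed.

Lemma smooth_near_continuous (V W : normedModType R) (x : V) (f : V -> W) :
  smooth_near x f -> {for x, continuous f}.
Proof. by move=> /nbhs_singleton /(_ 0%N); apply. Qed.

Lemma open_preimage_in (S T : topologicalType) (A : set S) (B : set T)
    (f : S -> T) : open A -> open B -> (forall x, A x -> {for x, continuous f}) ->
  open (A `&` f @^-1` B).
Proof.
move=> oA oB cf; rewrite openE => x [Ax Bfx]; apply: filterI.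
  exact: open_nbhs_nbhs.
by apply: (cf x Ax); exact: open_nbhs_nbhs.
Qed.

Lemma smooth_near_comp (V : normedModType R) n (x : V) (f : V -> 'rV[R]_n)
    (g : 'rV[R]_n -> R) :
  smooth_near x f -> smooth_near (f x) g -> smooth_near x (g \o f).
Proof.
move=> /smooth_nearP[A [oA Ax sA]] /smooth_nearP[B [oB Bx sB]].
have cf y : A y -> {for y, continuous f} by exact: (sA 0%N).
have oAB := open_preimage_in oA oB cf.
apply/smooth_nearP; exists (A `&` f @^-1` B); split => // k.
apply: (@Ck_comp _ _ _ _ _ B) => //; first by move=> y [].
by apply: Ck_sub (sA k) => y [].
Qed.

End SmoothNear.

Section ManifoldTheory.
Context {R : realType}.
Implicit Types N P : manifold R.

Definition smooth_at N (f : N -> R) (x : N) : Prop :=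
  forall n (c : chart R N n), atlas c -> cdom c x ->
    smooth_near (cmap c x) (f \o cinv c).

Lemma near_chart N n (c : chart R N n) (x : N) (A : set N) : cdom c x ->
  nbhs x A -> \forall y \near cmap c x, A (cinv c y).
Proof.
move=> cx xA; have ix : (cmap c @` cdom c) (cmap c x) by exists x.
by apply: (cinv_cont ix); rewrite cmapK.
Qed.

Lemma near_img N n (c : chart R N n) (x : N) : cdom c x ->
  \forall y \near cmap c x, (cmap c @` cdom c) y.
Proof.
by move=> cx; apply: open_nbhs_nbhs; split; [exact: cimg_open|exists x].
Qed.

Lemma near_dom N n (c : chart R N n) (x : N) : cdom c x ->
  \forall y \near x, cdom c y.
Proof. by move=> cx; exact: (open_nbhs_nbhs (conj (cdom_open c) cx)). Qed.

Lemma cinvK N n (c : chart R N n) y : (cmap c @` cdom c) y ->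
  cdom c (cinv c y) /\ cmap c (cinv c y) = y.
Proof. by move=> [x cx <-]; rewrite cmapK. Qed.

Lemma chart_change N n k (c : chart R N n) (d : chart R N k) (x : N) :
  atlas c -> atlas d -> cdom c x -> cdom d x ->
  smooth_near (cmap c x) (cmap d \o cinv c).
Proof.
move=> ac ad cx dx; have [s _] := atlas_compatible ac ad.
have h : \forall y \near cmap c x, (cmap c @` (cdom c `&` cdom d)) y.
  apply: filterS2 (near_img cx) (near_chart cx (near_dom dx)) => y.
  by move=> /cinvK[cy Ey] dy; exists (cinv c y).
by apply: filterS h => y hy k'; apply: Ck_sub (s k') => _ ->.
Qed.

Lemma smooth_at_eq N (f g : N -> R) x :
  (\forall y \near x, f y = g y) -> smooth_at f x -> smooth_at g x.
Proof.
move=> fg sf n c ac cx; apply: smooth_near_eq (sf n c ac cx).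
exact: near_chart fg.
Qed.

Lemma smooth_atP N (f : N -> R) : smooth_fun f <-> forall x, smooth_at f x.
Proof.
split=> [sf x n c ac cx|sf n c ac].
  apply/smooth_nearP; exists (cmap c @` cdom c); split; first exact: cimg_open.
    by exists x.
  exact: sf.
by apply: smooth_near_on => _ [x cx <-]; exact: sf.
Qed.

Lemma smooth_at_cst N (a : R) x : smooth_at (cst a : N -> R) x.
Proof. by move=> n c ac cx; exact: smooth_near_cst. Qed.

Lemma smooth_atD N (f g : N -> R) x :
  smooth_at f x -> smooth_at g x -> smooth_at (fun y => f y + g y) x.
Proof.
by move=> sf sg n c ac cx; apply: smooth_nearD; [exact: sf|exact: sg].
Qed.

Lemma smooth_atM N (f g : N -> R) x :
  smooth_at f x -> smooth_at g x -> smooth_at (fun y => f y * g y) x.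
Proof.
by move=> sf sg n c ac cx; apply: smooth_nearM; [exact: sf|exact: sg].
Qed.

Lemma smooth_at_comp_rV N k (G : N -> 'rV[R]_k) (g : 'rV[R]_k -> R) x :
  (forall i, smooth_at (fun y => G y 0 i) x) -> smooth_near (G x) g ->
  smooth_at (g \o G) x.
Proof.
move=> sG sg n c ac cx.
apply: (@smooth_near_comp _ _ _ _ (G \o cinv c)); last by rewrite /= cmapK.
by apply/smooth_near_coordP => i; exact: sG.
Qed.

Lemma continuous_rV_at N k (G : N -> 'rV[R]_k) x :
  (forall i, smooth_at (fun y => G y 0 i) x) -> {for x, continuous G}.
Proof.
move=> sG; have [n [c [ac cx]]] := atlas_cover x.
have sc : smooth_near (cmap c x) (G \o cinv c).
  by apply/smooth_near_coordP => i; exact: sG.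
have h : {for x, continuous ((G \o cinv c) \o cmap c)}.
  apply: continuous_comp; first exact: cmap_cont.
  exact: smooth_near_continuous.
rewrite /prop_for /continuous_at /= cmapK // in h.
apply: cvg_trans h; apply: near_eq_cvg.
apply: filterS (near_dom cx) => y cy /=.
by rewrite cmapK.
Qed.

Definition smooth_map_at N P (f : N -> P) (x : N) : Prop :=
  {for x, continuous f} /\
  forall k (d : chart R P k), atlas d -> cdom d (f x) ->
    forall i, smooth_at (fun y => cmap d (f y) 0 i) x.

Lemma smooth_mapP N P (f : N -> P) :
  smooth_map f <-> forall x, smooth_map_at f x.
Proof.
split=> [[cf sf] x|sf].
  split=> [|k d ad dx i n c ac cx]; first exact: cf.
  move: i; apply/(smooth_near_coordP _ (cmap d \o f \o cinv c)).
  have h : \forall y \near cmap c x, (cmap c @` (cdom c `&` f @^-1` cdom d)) y.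
    apply: filterS2 (near_img cx) (near_chart cx (cf x _ (near_dom dx))) => y.
    by move=> /cinvK[cy Ey] dy; exists (cinv c y).
  by apply: filterS h => y hy k'; apply: Ck_sub (sf n c k d ac ad k') => _ ->.
split=> [x|n c k d ac ad]; first by case: (sf x).
apply: smooth_near_on => _ [x [cx dx] <-].
apply/smooth_near_coordP => i; have [_ /(_ _ _ ad dx i)] := sf x.
exact.
Qed.

Lemma smooth_map_at_of N P (f : N -> P) x : smooth_map f -> smooth_map_at f x.
Proof. by move/smooth_mapP. Qed.

(** Continuity keeps [f y] in the domain of [d] for y near x; there the coordinates in any other
    chart are a smooth transition map applied to those in [d]. *)
Lemma smooth_map_at_chart N P (f : N -> P) (x : N) k (d : chart R P k) :
  {for x, continuous f} -> atlas d -> cdom d (f x) ->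
  (forall i, smooth_at (fun y => cmap d (f y) 0 i) x) -> smooth_map_at f x.
Proof.
move=> cf ad dx sd; split=> // k' d' ad' dx' i.
have h : \forall y \near x, cdom d (f y) by exact: (cf _ (near_dom dx)).
apply: (@smooth_at_eq _ ((fun z => cmap d' (cinv d z) 0 i) \o (cmap d \o f))).
  by apply: filterS h => y dy /=; rewrite cmapK.
apply: smooth_at_comp_rV => //=; move: i.
apply/(smooth_near_coordP _ (cmap d' \o cinv d)).
exact: chart_change.
Qed.

(** Continuity of [f] is a conclusion here, obtained from that of [G] and [cinv d]. This makes the
    criterion fit for maps that were chosen point by point. *)
Lemma smooth_map_at_cinv N P (f : N -> P) (x : N) k (d : chart R P k)
    (G : N -> 'rV[R]_k) : atlas d -> (cmap d @` cdom d) (G x) ->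
  (forall i, smooth_at (fun y => G y 0 i) x) ->
  (\forall y \near x, f y = cinv d (G y)) -> smooth_map_at f x.
Proof.
move=> ad dG sG fG; have cG := continuous_rV_at sG.
have fx : f x = cinv d (G x) by exact: nbhs_singleton fG.
have [dfx Ex] := cinvK dG.
apply: (@smooth_map_at_chart _ _ _ _ _ d) => //; last 2 first.
- by rewrite fx.
- have h : \forall y \near x, (cmap d @` cdom d) (G y).
    by apply: cG; apply: open_nbhs_nbhs; split => //; exact: cimg_open.
  move=> i; apply: smooth_at_eq (sG i).
  by apply: filterS2 fG h => y -> /cinvK[_ ->].
have h : {for x, continuous (cinv d \o G)}.
  by apply: continuous_comp => //; exact: cinv_cont.
rewrite /prop_for /continuous_at /= -fx in h.
apply: cvg_trans h; apply: near_eq_cvg.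
by apply: filterS fG => y /= ->.
Qed.

Lemma smooth_at_comp N P (f : N -> P) (g : P -> R) x :
  smooth_map_at f x -> smooth_at g (f x) -> smooth_at (g \o f) x.
Proof.
move=> [cf sf] sg; have [k [d [ad dx]]] := atlas_cover (f x).
have h : \forall y \near x, cdom d (f y) by exact: (cf _ (near_dom dx)).
apply: (@smooth_at_eq _ ((g \o cinv d) \o (cmap d \o f))).
  by apply: filterS h => y dy /=; rewrite cmapK.
by apply: smooth_at_comp_rV => [i|]; [exact: sf|exact: sg].
Qed.

Lemma smooth_fun_comp N P (f : N -> P) (g : P -> R) :
  smooth_map f -> smooth_fun g -> smooth_fun (g \o f).
Proof.
move=> /smooth_mapP sf /smooth_atP sg; apply/smooth_atP => x.
exact: smooth_at_comp.
Qed.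

Lemma smooth_map_comp N P (S : manifold R) (f : N -> P) (g : P -> S) :
  smooth_map f -> smooth_map g -> smooth_map (g \o f).
Proof.
move=> /smooth_mapP sf /smooth_mapP sg; apply/smooth_mapP => x; split.
  by apply: continuous_comp; [case: (sf x)|case: (sg (f x))].
move=> k d ad dx i.
apply: (@smooth_at_comp _ _ f (fun y => cmap d (g y) 0 i)) => //.
by case: (sg (f x)) => _; apply.
Qed.

Lemma smooth_at_cmap N n (c : chart R N n) x i : atlas c -> cdom c x ->
  smooth_at (fun y => cmap c y 0 i) x.
Proof.
move=> ac cx k d ad dx; move: i.
by apply/(smooth_near_coordP _ (cmap c \o cinv d)); exact: chart_change.
Qed.

Lemma smooth_map_id N : smooth_map (@id N).
Proof.
apply/smooth_mapP => x; split=> [|k d ad dx i]; first exact: cvg_id.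
exact: smooth_at_cmap.
Qed.

Lemma manifold_bump N n (c : chart R N n) (x : N) : atlas c -> cdom c x ->
  exists (chi : N -> R) (K : set N),
    [/\ smooth_fun chi, chi x = 1, closed K, K `<=` cdom c &
        forall y, ~ K y -> chi y = 0].
Proof.
move=> ac cx.
have [|chi [K [sc c1 cK Kc chi0]]] :=
  @rV_bump R n (cmap c x) _ (@cimg_open _ _ _ c); first by exists x.
pose K' := cinv c @` K.
pose chi' y := if pselect (cdom c y) then chi (cmap c y) else 0.
(* The Hausdorff axiom enters here: the compact set [K'] is closed in the manifold, so that
   extension by zero outside the chart is smooth. *)
have clK : closed K'.
  apply: compact_closed; first exact: m_hausdorff.
  apply: continuous_compact => //; apply: continuous_in_subspaceT => y.
  rewrite inE => /Kc; exact: cinv_cont.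
have K'c : K' `<=` cdom c by move=> _ [y /Kc /cinvK[? _] <-].
have chi'0 y : ~ K' y -> chi' y = 0.
  rewrite /chi'; case: pselect => // cy nK; apply: chi0 => Ky.
  by apply: nK; exists (cmap c y) => //; rewrite cmapK.
exists chi', K'; split => //; last by rewrite /chi'; case: pselect.
apply/smooth_atP => y; have [cy|ncy] := pselect (cdom c y).
  apply: (@smooth_at_eq _ (chi \o cmap c)).
    apply: filterS (near_dom cy) => z cz.
    by rewrite /chi'; case: pselect.
  apply: smooth_at_comp_rV => [i|]; first exact: smooth_at_cmap.
  by apply/smooth_nearP; exists setT; split => //; exact: openT.
apply: (@smooth_at_eq _ (cst 0)); last exact: smooth_at_cst.
have : nbhs y (~` K').
  by apply: open_nbhs_nbhs; split; [exact: closed_openC|move/K'c].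
by apply: filterS => z /chi'0.
Qed.

Lemma bump_mul_smooth N (chi h : N -> R) (K A : set N) : smooth_fun chi ->
  closed K -> K `<=` A -> (forall y, ~ K y -> chi y = 0) ->
  (forall y, A y -> smooth_at h y) -> smooth_fun (fun y => chi y * h y).
Proof.
move=> /smooth_atP schi clK KA chi0 sh; apply/smooth_atP => y.
have [Ay|nAy] := pselect (A y); first by apply: smooth_atM => //; exact: sh.
apply: (@smooth_at_eq _ (cst 0)); last exact: smooth_at_cst.
have : nbhs y (~` K).
  by apply: open_nbhs_nbhs; split; [exact: closed_openC|move/KA].
by apply: filterS => z nK; rewrite chi0 // mul0r.
Qed.

End ManifoldTheory.

(** * Vector bundles *)

Section VBundleTheory.
Context {R : realType} {E M : manifold R}.
Variable V : vbundle E M.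
Local Notation proj := (vproj V).
Local Notation add := (vadd V).
Local Notation scale := (vscale V).
Local Notation zero := (vzero V).
Local Notation is_chart := (vb_chart proj add scale zero).

Lemma vb_chart_inj n k (c : chart R M n) (d : chart R E (n + k)) T e e' :
  is_chart c d T -> cdom c (proj e) -> proj e = proj e' -> T e = T e' -> e = e'.
Proof.
move=> [_ _ uT _] ce ee' TT; have [e0 [_ u0]] := uT _ (T e) ce.
by rewrite -(u0 e) // -(u0 e').
Qed.

Lemma vb_chart_dom n k (c : chart R M n) (d : chart R E (n + k)) T e :
  is_chart c d T -> cdom d e = cdom c (proj e).
Proof. by move=> [[_ _ ->] _ _ _]. Qed.

(** Each fibre embeds linearly in some R^k, so the vector space laws in the fibres below are pulled
    back along [T]. *)
Lemma vb_fibreP m : exists k (T : E -> 'rV[R]_k),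
  [/\ forall e e', proj e = m -> proj e' = m -> T e = T e' -> e = e',
      forall e e', proj e = m -> proj e' = m -> T (add e e') = T e + T e',
      forall a e, proj e = m -> T (scale a e) = a *: T e &
      T (zero m) = 0].
Proof.
have [n [k [c [d [T [h cm]]]]]] := vlocal V m.
exists k, T; have [_ _ _ [hD hZ h0]] := h; split.
- move=> e e' em e'm; apply: (vb_chart_inj h); first by rewrite em.
  by rewrite em e'm.
- by move=> e e' em e'm; apply: hD; rewrite ?(vb_chart_dom _ h) ?em.
- by move=> a e em; apply: hZ; rewrite (vb_chart_dom _ h) em.
- exact: h0.
Qed.

Lemma vaddC e e' : proj e = proj e' -> add e e' = add e' e.
Proof.
move=> p; have [k [T [Ti TD _ _]]] := vb_fibreP (proj e).
by apply: Ti; rewrite ?vproj_add // !TD // addrC.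
Qed.

Lemma vaddACA e1 e2 e3 e4 :
  proj e2 = proj e1 -> proj e3 = proj e1 -> proj e4 = proj e1 ->
  add (add e1 e2) (add e3 e4) = add (add e1 e3) (add e2 e4).
Proof.
move=> p2 p3 p4; have [k [T [Ti TD _ _]]] := vb_fibreP (proj e1).
by apply: Ti; rewrite ?vproj_add ?TD ?vproj_add ?p2 ?p3 ?p4 // addrACA.
Qed.

Lemma vadd0 e : add (zero (proj e)) e = e.
Proof.
have [k [T [Ti TD _ T0]]] := vb_fibreP (proj e).
by apply: Ti; rewrite ?vproj_add ?TD ?vproj_zero // T0 add0r.
Qed.

Lemma vaddr0 e : add e (zero (proj e)) = e.
Proof. by rewrite vaddC ?vproj_zero // vadd0. Qed.

Lemma vscale1 e : scale 1 e = e.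
Proof.
have [k [T [Ti _ TZ _]]] := vb_fibreP (proj e).
by apply: Ti; rewrite ?vproj_scale // TZ // scale1r.
Qed.

Lemma vscale0 e : scale 0 e = zero (proj e).
Proof.
have [k [T [Ti _ TZ T0]]] := vb_fibreP (proj e).
by apply: Ti; rewrite ?vproj_scale ?vproj_zero // TZ // scale0r T0.
Qed.

Lemma vscale_zero a m : scale a (zero m) = zero m.
Proof.
have [k [T [Ti _ TZ T0]]] := vb_fibreP m.
by apply: Ti; rewrite ?vproj_scale ?vproj_zero // TZ ?vproj_zero // T0 scaler0.
Qed.

Lemma vscaleA a b e : scale a (scale b e) = scale (a * b) e.
Proof.
have [k [T [Ti _ TZ _]]] := vb_fibreP (proj e).
by apply: Ti; rewrite ?vproj_scale // !TZ ?vproj_scale // scalerA.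
Qed.

Lemma vscaleDl a b e : scale (a + b) e = add (scale a e) (scale b e).
Proof.
have [k [T [Ti TD TZ _]]] := vb_fibreP (proj e).
by apply: Ti; rewrite ?vproj_add ?vproj_scale // TD ?vproj_scale // !TZ // scalerDl.
Qed.

Lemma vscaleDr a e e' : proj e = proj e' ->
  scale a (add e e') = add (scale a e) (scale a e').
Proof.
move=> p; have [k [T [Ti TD TZ _]]] := vb_fibreP (proj e).
apply: Ti; rewrite ?vproj_scale ?vproj_add ?vproj_scale //.
by rewrite TZ ?TD ?vproj_add ?vproj_scale // !TZ // scalerDr.
Qed.

Lemma vaddNe e : add e (scale (-1) e) = zero (proj e).
Proof. by rewrite -{1}[e]vscale1 -vscaleDl subrr vscale0. Qed.

Lemma vaddKB e e' : proj e = proj e' -> add e' (add e (scale (-1) e')) = e.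
Proof.
move=> p; have [k [T [Ti TD TZ _]]] := vb_fibreP (proj e).
apply: Ti; rewrite ?vproj_add ?vproj_scale //.
rewrite TD ?vproj_add ?vproj_scale // TD ?vproj_scale //.
by rewrite TZ // scaleN1r addrC subrK.
Qed.

Lemma vaddKl e e' : proj e = proj e' -> add (add e e') (scale (-1) e) = e'.
Proof.
move=> p; have [k [T [Ti TD TZ _]]] := vb_fibreP (proj e).
apply: Ti; rewrite ?vproj_add ?vproj_scale //.
rewrite TD ?vproj_add ?vproj_scale // TD // TZ // scaleN1r.
by rewrite addrAC subrr add0r.
Qed.

Section Smooth.
Variable P : manifold R.

Lemma vb_chart_smooth_at n k (c : chart R M n) (d : chart R E (n + k)) T
    (f : P -> E) (x : P) i : is_chart c d T -> cdom c (proj (f x)) ->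
  smooth_map_at f x -> smooth_at (fun y => T (f y) 0 i) x.
Proof.
move=> h cx [cf sf]; have [[_ ad _] dE _ _] := h.
have dx : cdom d (f x) by rewrite (vb_chart_dom _ h).
apply: smooth_at_eq (sf _ d ad dx (rshift n i)).
have : \forall y \near x, cdom d (f y) by exact: (cf _ (near_dom dx)).
by apply: filterS => y dy; rewrite dE // row_mxEr.
Qed.

Lemma vb_smooth_map_at n k (c : chart R M n) (d : chart R E (n + k)) T
    (f : P -> E) (x : P) : is_chart c d T -> cdom c (proj (f x)) ->
  smooth_map_at (proj \o f) x ->
  (forall i, smooth_at (fun y => T (f y) 0 i) x) -> smooth_map_at f x.
Proof.
move=> h cx [cf sf] sT; have [[ac ad _] dE _ _] := h.
have dx : cdom d (f x) by rewrite (vb_chart_dom _ h).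
apply: (@smooth_map_at_cinv _ _ _ _ _ _ d
  (fun y => row_mx (cmap c (proj (f y))) (T (f y)))) => //.
- by exists (f x) => //; rewrite dE.
- move=> i; have [j ->|j ->] := split_ordP i.
    by under eq_fun do rewrite row_mxEl; exact: sf.
  by under eq_fun do rewrite row_mxEr; exact: sT.
- have : \forall y \near x, cdom c (proj (f y)) by exact: (cf _ (near_dom cx)).
  apply: filterS => y cy.
  by rewrite -dE ?cmapK // (vb_chart_dom _ h).
Qed.

Lemma vadd_smooth (f g : P -> E) : smooth_map f -> smooth_map g ->
  (forall x, proj (f x) = proj (g x)) -> smooth_map (fun x => add (f x) (g x)).
Proof.
move=> sf sg fg; apply/smooth_mapP => x.
have [n [k [c [d [T [h cx]]]]]] := vlocal V (proj (f x)).
have [_ _ _ [TD _ _]] := h.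
have spf : smooth_map (proj \o f).
  exact: smooth_map_comp sf (vproj_smooth V).
apply: (vb_smooth_map_at h); first by rewrite vproj_add.
  rewrite (_ : _ \o _ = proj \o f); first exact: smooth_map_at_of.
  by apply/funext => y /=; rewrite vproj_add.
move=> i; apply: (@smooth_at_eq _ _ (fun y => T (f y) 0 i + T (g y) 0 i)).
  have : \forall y \near x, cdom c (proj (f y)).
    by have [+ _] := spf; move=> /(_ x _ (near_dom cx)).
  apply: filterS => y cy.
  by rewrite TD ?mxE// (vb_chart_dom _ h).
apply: smooth_atD; apply: (vb_chart_smooth_at _ h) => //.
- exact: smooth_map_at_of.
- by rewrite -fg.
- exact: smooth_map_at_of.
Qed.

Lemma vscale_smooth (a : P -> R) (f : P -> E) : smooth_fun a -> smooth_map f ->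
  smooth_map (fun x => scale (a x) (f x)).
Proof.
move=> /smooth_atP sa sf; apply/smooth_mapP => x.
have [n [k [c [d [T [h cx]]]]]] := vlocal V (proj (f x)).
have [_ _ _ [_ TZ _]] := h.
have spf : smooth_map (proj \o f).
  exact: smooth_map_comp sf (vproj_smooth V).
apply: (vb_smooth_map_at h); first by rewrite vproj_scale.
  rewrite (_ : _ \o _ = proj \o f); first exact: smooth_map_at_of.
  by apply/funext => y /=; rewrite vproj_scale.
move=> i; apply: (@smooth_at_eq _ _ (fun y => a y * T (f y) 0 i)).
  have : \forall y \near x, cdom c (proj (f y)).
    by have [+ _] := spf; move=> /(_ x _ (near_dom cx)).
  apply: filterS => y cy.
  by rewrite TZ ?mxE// (vb_chart_dom _ h).
apply: smooth_atM => //; apply: (vb_chart_smooth_at _ h) => //.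
exact: smooth_map_at_of.
Qed.

End Smooth.

Lemma vzero_smooth : smooth_map zero.
Proof.
apply/smooth_mapP => x.
have [n [k [c [d [T [h cx]]]]]] := vlocal V x.
have [_ _ _ [_ _ T0]] := h.
apply: (vb_smooth_map_at h); first by rewrite vproj_zero.
  rewrite (_ : _ \o _ = id); first exact: smooth_map_at_of (smooth_map_id M).
  by apply/funext => y /=; rewrite vproj_zero.
move=> i; apply: (@smooth_at_eq _ _ (cst 0)); last exact: smooth_at_cst.
by apply: filterS (near_dom cx) => y cy; rewrite T0 // mxE.
Qed.

Lemma vscale_section (a : M -> R) s : smooth_fun a -> section V s ->
  section V (fun m => scale (a m) (s m)).
Proof.
by move=> sa [ss ps]; split=> [|m]; [exact: vscale_smooth|rewrite vproj_scale].
Qed.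

(** The section is constant in the chart, multiplied by a bump function and extended by zero. That
    its values are multiples of [T e] keeps it inside any subbundle that the chart flattens and that
    contains e. *)
Lemma vb_chart_section n k (c : chart R M n) (d : chart R E (n + k)) T e :
  is_chart c d T -> cdom c (proj e) ->
  exists s, [/\ section V s, s (proj e) = e,
    forall m, ~ cdom c m -> s m = zero m &
    forall m, cdom c m -> exists a, T (s m) = a *: T e].
Proof.
move=> h ce; have [[ac ad _] dE uT [_ _ T0]] := h.
have [chi [K [schi chi1 clK Kc chi0]]] := manifold_bump ac ce.
have ex m : exists e', proj e' = m /\
    (cdom c m -> T e' = chi m *: T e) /\ (~ cdom c m -> e' = zero m).
  have [cm|ncm] := pselect (cdom c m).
    by have [e' [[p Te'] _]] := uT m (chi m *: T e) cm; exists e'.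
  by exists (zero m); rewrite vproj_zero; split.
have [s sP] := choice ex.
have sp m : proj (s m) = m by have [] := sP m.
have sT m : cdom c m -> T (s m) = chi m *: T e by have [_ [+ _]] := sP m.
have s0 m : ~ cdom c m -> s m = zero m by have [_ [_ +]] := sP m.
exists s; split => //; last by move=> m cm; exists (chi m); exact: sT.
  split=> //; apply/smooth_mapP => m; have [cm|ncm] := pselect (cdom c m).
    apply: (vb_smooth_map_at h); first by rewrite sp.
      rewrite (_ : _ \o _ = id); first exact: smooth_map_at_of (smooth_map_id M).
      by apply/funext => y /=; rewrite sp.
    move=> i; apply: (@smooth_at_eq _ _ (fun y => chi y * T e 0 i)).
      by apply: filterS (near_dom cm) => y cy; rewrite sT // mxE.
    by apply: smooth_atM; [exact: (smooth_atP _).1|exact: smooth_at_cst].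
  (* At a point outside the chart, smoothness is read in another bundle chart, where the section
     agrees near m with the zero section. *)
  have near0 : \forall y \near m, s y = zero y.
    have : nbhs m (~` K).
      by apply: open_nbhs_nbhs; split; [exact: closed_openC|move/Kc].
    apply: filterS => y nK; have [cy|/s0//] := pselect (cdom c y).
    apply: (vb_chart_inj h); rewrite ?sp ?vproj_zero // sT // chi0 //.
    by rewrite scale0r T0.
  have [n' [k' [c' [d' [T' [h' cm']]]]]] := vlocal V m.
  have [_ _ _ [_ _ T'0]] := h'.
  apply: (vb_smooth_map_at h'); first by rewrite sp.
    rewrite (_ : _ \o _ = id); first exact: smooth_map_at_of (smooth_map_id M).
    by apply/funext => y /=; rewrite sp.
  move=> i; apply: (@smooth_at_eq _ _ (cst 0)); last exact: smooth_at_cst.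
  by apply: filterS2 near0 (near_dom cm') => y -> cy; rewrite T'0 // mxE.
apply: (vb_chart_inj h); rewrite ?sp // sT // chi1 scale1r //.
Qed.

Lemma vb_section e : exists2 s, section V s & s (proj e) = e.
Proof.
have [n [k [c [d [T [h ce]]]]]] := vlocal V (proj e).
by have [s [ss se _ _]] := vb_chart_section h ce; exists s.
Qed.

Lemma subbundle_fibre (S : set M) (D : set E) m : subbundle V S D -> S m ->
  fibre_subspace V m (D `&` [set e | proj e = m]).
Proof.
move=> [_ _ loc] Sm; have [n [k [c [d [T [r [h cm hD]]]]]]] := loc m Sm.
have [_ _ _ [TD TZ T0]] := h.
have dP e : proj e = m -> cdom d e by rewrite (vb_chart_dom _ h) => ->.
have DP e : proj e = m -> (D e <-> forall i : 'I_k, (r <= i)%N -> T e 0 i = 0).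
  by move=> em; apply: hD; [exact: dP|rewrite em].
split=> [e []//||e e' [De em] [De' em']|a e [De em]]; split => /=.
- by apply/DP; [exact: vproj_zero|move=> i _; rewrite T0 // mxE].
- exact: vproj_zero.
- apply/DP; first by rewrite vproj_add ?em.
  move=> i ri; rewrite TD ?em ?em' //; last exact: dP.
  by rewrite mxE ((DP _ em).1 De) // ((DP _ em').1 De') // addr0.
- by rewrite vproj_add ?em.
- apply/DP; first by rewrite vproj_scale.
  move=> i ri; rewrite TZ; last exact: dP.
  by rewrite mxE ((DP _ em).1 De) // mulr0.
- by rewrite vproj_scale.
Qed.

Lemma subbundle_section (S : set M) (D : set E) e : subbundle V S D -> D e ->
  exists s, [/\ section V s, s (proj e) = e & forall m, S m -> D (s m)].
Proof.
move=> sD De; have [_ DS loc] := sD; have Se := DS _ De.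
have [n [k [c [d [T [r [h ce hD]]]]]]] := loc _ Se.
have [s [ss se s0 sT]] := vb_chart_section h ce; exists s; split => // m Sm.
have [cm|/s0->] := pselect (cdom c m); last first.
  by have [_ [Dz _] _ _] := subbundle_fibre sD Sm.
have [_ ps] := ss.
apply/hD; rewrite ?(vb_chart_dom _ h) ?ps //.
move=> i ri; have [a ->] := sT _ cm; rewrite mxE.
by rewrite ((hD e _ _).1 De) ?mulr0 // (vb_chart_dom _ h).
Qed.

(** The cutoff depends only on the base point, so that multiplying by it preserves linearity on
    whole fibres. *)
Lemma vb_chart_linear_fun n k (c : chart R M n) (d : chart R E (n + k)) T m i :
  is_chart c d T -> cdom c m ->
  exists chi, [/\ smooth_fun chi, chi m = 1,
    linear_fun V (fun e => chi (proj e) * T e 0 i) &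
    forall y, ~ cdom c y -> chi y = 0].
Proof.
move=> h cm; have [[ac ad _] dE uT [TD TZ T0]] := h.
have [chi [K [schi chi1 clK Kc chi0]]] := manifold_bump ac cm.
have chi0' y : ~ cdom c y -> chi y = 0 by move=> ncy; apply: chi0 => /Kc.
have [cp _] := vproj_smooth V.
exists chi; split => //; split.
- apply: (@bump_mul_smooth _ _ (chi \o proj) _ (proj @^-1` K) (proj @^-1` cdom c)).
  + exact: smooth_fun_comp (vproj_smooth V) schi.
  + by apply: preimage_closed => // y _; exact: cp.
  + by move=> y /Kc.
  + by move=> y; exact: chi0.
  + move=> e ce; apply: (vb_chart_smooth_at _ h ce).
    exact: smooth_map_at_of (smooth_map_id E).
- move=> e e' ee'; rewrite vproj_add //; have [ce|nce] := pselect (cdom c (proj e)).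
    by rewrite TD ?(vb_chart_dom _ h) // mxE mulrDr ee'.
  by rewrite -ee' chi0' // !mul0r addr0.
- move=> a e; rewrite vproj_scale; have [ce|nce] := pselect (cdom c (proj e)).
    by rewrite TZ ?(vb_chart_dom _ h) // mxE mulrCA.
  by rewrite chi0' // !mul0r mulr0.
Qed.

(** Some transverse coordinate of e in a flattening chart is nonzero; its cutoff vanishes on [D].
    Membership in B' is thereby tested on linear functions, the ones that [nabla] controls. *)
Lemma subbundle_separation (D : set E) e : subbundle V setT D -> ~ D e ->
  exists l, [/\ linear_fun V l, forall e', D e' -> l e' = 0 & l e <> 0].
Proof.
move=> sD nDe; have [_ _ loc] := sD.
have [n [k [c [d [T [r [h ce hD]]]]]]] := loc (proj e) I.
have [i [ri Ti]] : exists i : 'I_k, (r <= i)%N /\ T e 0 i <> 0.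
  apply: contrapT => H; apply: nDe; apply/hD => //.
    by rewrite (vb_chart_dom _ h).
  by move=> i ri; apply: contrapT => Ti; apply: H; exists i.
have [chi [_ chi1 ll chi0]] := vb_chart_linear_fun i h ce.
exists (fun e => chi (proj e) * T e 0 i); split => //; last by rewrite chi1 mul1r.
move=> e' De'; have [ce'|/chi0->] := pselect (cdom c (proj e')); last by rewrite mul0r.
by rewrite ((hD e' _ _).1 De') ?mulr0 // (vb_chart_dom _ h).
Qed.

End VBundleTheory.

(** * Double vector bundles *)

Section DoubleVectorBundles.
Context {R : realType} {E Q B M : manifold R}.
Variable V : dvb E Q B M.
Local Notation pQ := (vproj (EQ V)).
Local Notation pB := (vproj (EB V)).
Local Notation qM := (vproj (QM V)).
Local Notation bM := (vproj (BM V)).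
Local Notation "x +Q y" := (vadd (EQ V) x y) (at level 50, left associativity).
Local Notation "x +B y" := (vadd (EB V) x y) (at level 50, left associativity).

(** The common pointwise form of [dagger] and [phi_tilde], for a single core element. *)
Definition core_lift (b : B) (c : E) : E := vzero (EB V) b +Q c.

Lemma pB_zeroQ q : pB (vzero (EQ V) q) = vzero (BM V) (qM q).
Proof.
have [_ _ _ _ hZ] := dvb_proj V.
rewrite -{1}[q](vproj_zero (EQ V)) -vscale0 hZ vscale0.
by rewrite -dvb_square !vproj_zero.
Qed.

Lemma pQ_zeroB b : pQ (vzero (EB V) b) = vzero (QM V) (bM b).
Proof. by have [_ _ + _ _] := dvb_zero V; apply. Qed.

Lemma zeroB_zeroQ m :
  vzero (EB V) (vzero (BM V) m) = vzero (EQ V) (vzero (QM V) m).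
Proof.
have [_ _ _ _ hZ] := dvb_zero V.
have := hZ 0 (vzero (BM V) m); rewrite !vscale0 vproj_zero => ->.
by rewrite pQ_zeroB vproj_zero.
Qed.

Lemma pQ_scaleB a e : pQ (vscale (EB V) a e) = vscale (QM V) a (pQ e).
Proof. by have [_ _ + _ _] := dvb_scale V a; apply. Qed.

Lemma pB_addQ e e' : pQ e = pQ e' -> pB (e +Q e') = vadd (BM V) (pB e) (pB e').
Proof. by have [_ _ _ + _] := dvb_proj V; apply. Qed.

Lemma pB_scaleQ a e : pB (vscale (EQ V) a e) = vscale (BM V) a (pB e).
Proof. by have [_ _ _ _] := dvb_proj V; apply. Qed.

Lemma core_lift_pB b c : core V (bM b) c -> pB (core_lift b c) = b.
Proof.
move=> [c1 c2]; rewrite pB_addQ ?pQ_zeroB ?c1 // c2 vproj_zero.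
by rewrite vaddC ?vproj_zero // vadd0.
Qed.

Lemma core_lift_pQ b c : core V (bM b) c ->
  pQ (core_lift b c) = vzero (QM V) (bM b).
Proof. by move=> [c1 c2]; rewrite vproj_add pQ_zeroB ?c1. Qed.

Lemma coreD m c c' : core V m c -> core V m c' -> core V m (c +B c').
Proof.
move=> [c1 c2] [c1' c2']; split; last by rewrite vproj_add c2 ?c2'.
rewrite dvb_add_proj ?c2 ?c2' // c1 c1'.
by rewrite -[X in vadd _ (vzero _ X)](vproj_zero (QM V) m) vadd0.
Qed.

Lemma coreZ m a c : core V m c -> core V m (vscale (EB V) a c).
Proof.
move=> [c1 c2]; split; last by rewrite vproj_scale.
by rewrite pQ_scaleB c1 vscale_zero.
Qed.

Lemma core_liftD b c c' : core V (bM b) c -> core V (bM b) c' ->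
  core_lift b (c +B c') = core_lift b c +B core_lift b c'.
Proof.
move=> [c1 c2] [c1' c2']; rewrite /core_lift.
have {1}-> : vzero (EB V) b = vzero (EB V) b +B vzero (EB V) b.
  by rewrite -[X in vadd _ (vzero _ X)](vproj_zero (EB V) b) vadd0.
by apply: dvb_add_add; rewrite ?c2 ?c2' ?pQ_zeroB ?c1 ?c1'.
Qed.

Lemma core_liftZ b a c : core V (bM b) c ->
  core_lift b (vscale (EB V) a c) = vscale (EB V) a (core_lift b c).
Proof.
move=> [c1 c2]; rewrite /core_lift; have [_ _ _ hD _] := dvb_scale V a.
by rewrite hD ?vscale_zero // pQ_zeroB c1.
Qed.

Lemma core_lift_zero m c : core V m c -> core_lift (vzero (BM V) m) c = c.
Proof. by move=> [c1 c2]; rewrite /core_lift zeroB_zeroQ -c1 vadd0. Qed.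

(** The core element is e minus 0_b, taken over Q, where both have the same projection. *)
Lemma core_lift_ex e : pQ e = vzero (QM V) (bM (pB e)) ->
  exists2 c, core V (bM (pB e)) c & e = core_lift (pB e) c.
Proof.
move=> e0; set b := pB e in e0 *.
have E0 : pQ e = pQ (vzero (EB V) b) by rewrite pQ_zeroB.
exists (e +Q vscale (EQ V) (-1) (vzero (EB V) b)).
  split; first by rewrite vproj_add ?vproj_scale.
  rewrite pB_addQ ?vproj_scale // pB_scaleQ vproj_zero.
  by rewrite vaddNe.
by rewrite /core_lift vaddKB.
Qed.

Section Splitting.
Variable Sigma : Q -> B -> E.
Context (hS : linear_splitting V Sigma).

Lemma splitting_pQ q b : qM q = bM b -> pQ (Sigma q b) = q.
Proof. by have [_ /(_ q b) + _ _ _] := hS => /[apply] -[]. Qed.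

Lemma splitting_pB q b : qM q = bM b -> pB (Sigma q b) = b.
Proof. by have [_ /(_ q b) + _ _ _] := hS => /[apply] -[]. Qed.

Lemma splittingD q q' b : qM q = bM b -> qM q' = bM b ->
  Sigma (vadd (QM V) q q') b = Sigma q b +B Sigma q' b.
Proof. by have [_ _ + _ _] := hS; apply. Qed.

Lemma splittingZ a q b : qM q = bM b ->
  Sigma (vscale (QM V) a q) b = vscale (EB V) a (Sigma q b).
Proof. by have [_ _ _ _ /(_ a q b) +] := hS => /[apply] -[]. Qed.

Lemma splitting_zero b : Sigma (vzero (QM V) (bM b)) b = vzero (EB V) b.
Proof.
have q0 : qM (vzero (QM V) (bM b)) = bM b by rewrite vproj_zero.
by rewrite -(vscale_zero (QM V) 0) splittingZ // vscale0 splitting_pB.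
Qed.

(** Subtracting [Sigma (pQ e) (pB e)] over B leaves an element whose projection to Q is zero, that
    is, a lifted core element. *)
Lemma splitting_decomp e : exists2 c, core V (bM (pB e)) c &
  e = Sigma (pQ e) (pB e) +B core_lift (pB e) c.
Proof.
set q := pQ e; set b := pB e.
have qb : qM q = bM b by rewrite dvb_square.
pose k := e +B vscale (EB V) (-1) (Sigma q b).
have kB : pB k = b by rewrite vproj_add // vproj_scale splitting_pB.
have kQ : pQ k = vzero (QM V) (bM (pB k)).
  rewrite kB dvb_add_proj ?vproj_scale ?splitting_pB // pQ_scaleB.
  by rewrite splitting_pQ // vaddNe -qb.
have [c cc kE] := core_lift_ex kQ; rewrite kB in cc kE.
by exists c => //; rewrite -kE vaddKB // splitting_pB.
Qed.

Lemma splitting_sum_pB q b c : qM q = bM b -> core V (bM b) c ->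
  pB (Sigma q b +B core_lift b c) = b.
Proof.
by move=> qb cc; rewrite vproj_add splitting_pB // core_lift_pB.
Qed.

Lemma splitting_sum_pQ q b c : qM q = bM b -> core V (bM b) c ->
  pQ (Sigma q b +B core_lift b c) = q.
Proof.
move=> qb cc; rewrite dvb_add_proj ?splitting_pB ?core_lift_pB //.
rewrite splitting_pQ // core_lift_pQ // -qb vaddC ?vproj_zero //.
exact: vadd0.
Qed.

Lemma splitting_sumD q q' b c c' : qM q = bM b -> qM q' = bM b ->
  core V (bM b) c -> core V (bM b) c' ->
  (Sigma q b +B core_lift b c) +B (Sigma q' b +B core_lift b c') =
  Sigma (vadd (QM V) q q') b +B core_lift b (c +B c').
Proof.
move=> qb qb' cc cc'; rewrite splittingD // core_liftD // vaddACA //.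
- by rewrite core_lift_pB // splitting_pB.
- by rewrite !splitting_pB.
- by rewrite core_lift_pB // splitting_pB.
Qed.

Lemma splitting_sumZ a q b c : qM q = bM b -> core V (bM b) c ->
  vscale (EB V) a (Sigma q b +B core_lift b c) =
  Sigma (vscale (QM V) a q) b +B core_lift b (vscale (EB V) a c).
Proof.
move=> qb cc; rewrite splittingZ // core_liftZ // vscaleDr //.
by rewrite core_lift_pB // splitting_pB.
Qed.

Lemma sigmaQ_section q : section (QM V) q -> section (EB V) (sigmaQ V Sigma q).
Proof.
move=> [sq pq]; split=> [|b]; last by rewrite /sigmaQ splitting_pB.
(* Smoothness of [Sigma] on the fibre product is tested on B itself, mapped by b |-> (q over the
   base point of b, b). *)
have [sS _ _ _ _] := hS; apply: (sS B (q \o bM) id) => [| |b /=].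
- exact: smooth_map_comp (vproj_smooth (BM V)) sq.
- exact: smooth_map_id.
- exact: pq.
Qed.

End Splitting.

Lemma dagger_section c : section_core V c -> section (EB V) (dagger V c).
Proof.
move=> [sc cc]; split=> [|b]; last exact: core_lift_pB.
apply: vadd_smooth => [| |b]; first exact: vzero_smooth.
  exact: smooth_map_comp (vproj_smooth (BM V)) sc.
by have [-> _] := cc (bM b); rewrite pQ_zeroB.
Qed.

End DoubleVectorBundles.

Section PairingTheory.
Context {R : realType} {E N : manifold R} {V : vbundle E N}.
Variable K : courant V.

Lemma cpairDr e1 e2 e' : vproj V e1 = vproj V e2 -> vproj V e1 = vproj V e' ->
  cpair K e' (vadd V e1 e2) = cpair K e' e1 + cpair K e' e2.
Proof.
move=> p1 p2; rewrite (@cpair_sym _ _ _ _ K) ?vproj_add -?p1 // cpairD //.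
by rewrite (@cpair_sym _ _ _ _ K) // [cpair K e2 _](@cpair_sym _ _ _ _ K) // -p1.
Qed.

Lemma cpairZr a e e' : vproj V e = vproj V e' ->
  cpair K e' (vscale V a e) = a * cpair K e' e.
Proof.
move=> p; rewrite (@cpair_sym _ _ _ _ K) ?vproj_scale // cpairZ //.
by rewrite (@cpair_sym _ _ _ _ K).
Qed.

Lemma cpair0 e : cpair K (vzero V (vproj V e)) e = 0.
Proof. by rewrite -vscale0 cpairZ // mul0r. Qed.

Lemma canchor0 x f : smooth_fun f -> canchor K (vzero V x) f = 0.
Proof.
move=> sf; have [_ _ _ _ hZ] := canchor_morphism K.
by have := hZ 0 (vzero V x) f sf; rewrite vscale_zero mul0r.
Qed.

End PairingTheory.

Section MetricDVB.
Context {R : realType} {E Q B M : manifold R}.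
Context {V : dvb E Q B M} {K : courant (EB V)}.
Context (hM : metric_dvb K).
Local Notation pQ := (vproj (EQ V)).
Local Notation pB := (vproj (EB V)).
Local Notation qM := (vproj (QM V)).
Local Notation bM := (vproj (BM V)).
Local Notation "x +Q y" := (vadd (EQ V) x y) (at level 50, left associativity).
Local Notation "x +B y" := (vadd (EB V) x y) (at level 50, left associativity).

Lemma cpair_core_lift e c : core V (bM (pB e)) c ->
  cpair K e (core_lift V (pB e) c) = qpair K (pQ e) c.
Proof. by have [+ _ _] := hM; apply. Qed.

Lemma qpair0 m c : core V m c -> qpair K (vzero (QM V) m) c = 0.
Proof. by move=> [_ c2]; rewrite /qpair -zeroB_zeroQ -c2 cpair0. Qed.

Lemma cpair_core_core b c c' : core V (bM b) c -> core V (bM b) c' ->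
  cpair K (core_lift V b c) (core_lift V b c') = 0.
Proof.
move=> cc cc'; have pb := core_lift_pB cc.
by have := @cpair_core_lift (core_lift V b c) c'; rewrite pb core_lift_pQ // => ->;
  rewrite ?qpair0.
Qed.

Lemma annihilatorD (U : set Q) m c c' : annihilator K U m c ->
  annihilator K U m c' -> annihilator K U m (c +B c').
Proof.
move=> [cc ac] [cc' ac']; split=> [|u Uu um]; first exact: coreD.
have [[_ c2] [_ c2']] := (cc, cc').
have := ac u Uu um; have := ac' u Uu um; rewrite /qpair => h' h.
by rewrite cpairDr ?c2 ?c2' ?pB_zeroQ ?um // h h' addr0.
Qed.

Lemma annihilatorZ (U : set Q) m a c : annihilator K U m c ->
  annihilator K U m (vscale (EB V) a c).
Proof.
move=> [cc ac]; split=> [|u Uu um]; first exact: coreZ.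
have [_ c2] := cc.
have := ac u Uu um; rewrite /qpair => h.
by rewrite cpairZr ?c2 ?pB_zeroQ ?um // h mulr0.
Qed.

Section Splitting.
Context {Sigma : Q -> B -> E} (hS : lagrangian_splitting K Sigma).
Let hL := hS.1.

Lemma cpair_splitting q q' b : qM q = bM b -> qM q' = bM b ->
  cpair K (Sigma q b) (Sigma q' b) = 0.
Proof.
move=> qb qb'; have [_ iso _] := hS.2 b I.
by apply: iso; split; rewrite /= ?(splitting_pB hL) //;
  [exists q, b|exists q', b].
Qed.

Lemma cpair_splitting_core q b c : qM q = bM b -> core V (bM b) c ->
  cpair K (Sigma q b) (core_lift V b c) = qpair K q c.
Proof.
move=> qb cc; have := @cpair_core_lift (Sigma q b) c.
by rewrite (splitting_pB hL) // (splitting_pQ hL) //; apply.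
Qed.

Lemma cpair_splitting_sum q q' b c c' : qM q = bM b -> qM q' = bM b ->
  core V (bM b) c -> core V (bM b) c' ->
  cpair K (Sigma q b +B core_lift V b c) (Sigma q' b +B core_lift V b c') =
  qpair K q c' + qpair K q' c.
Proof.
move=> qb qb' cc cc'.
have [p1 p2] := (splitting_pB hL qb, splitting_pB hL qb').
have [p3 p4] := (core_lift_pB cc, core_lift_pB cc').
rewrite cpairD ?vproj_add ?p1 ?p2 ?p3 ?p4 //.
rewrite !cpairDr ?p1 ?p2 ?p3 ?p4 // cpair_splitting // cpair_core_core //.
rewrite addr0 add0r cpair_splitting_core // (@cpair_sym _ _ _ _ K) ?p3 ?p2 //.
by rewrite cpair_splitting_core.
Qed.

(** [qpair] is defined by zeros of E over Q, while the pairing is additive over B. Expressing it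
    through [Sigma] at a point b over m turns addition in Q into addition over B; the zero vector
    supplies such a b. *)
Lemma qpairD q q' m c : qM q = m -> qM q' = m -> core V m c ->
  qpair K (vadd (QM V) q q') c = qpair K q c + qpair K q' c.
Proof.
move=> qm qm' cc; pose b := vzero (BM V) m.
have bm : bM b = m by rewrite vproj_zero.
have [qb qb'] : qM q = bM b /\ qM q' = bM b by rewrite bm.
have cb : core V (bM b) c by rewrite bm.
rewrite -!(@cpair_splitting_core _ b) ?vproj_add // ?qb //.
rewrite (splittingD hL) // cpairD ?(splitting_pB hL) //.
by rewrite core_lift_pB.
Qed.

Lemma qpairZ a q m c : qM q = m -> core V m c ->
  qpair K (vscale (QM V) a q) c = a * qpair K q c.
Proof.
move=> qm cc; pose b := vzero (BM V) m.
have bm : bM b = m by rewrite vproj_zero.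
have qb : qM q = bM b by rewrite bm.
have cb : core V (bM b) c by rewrite bm.
rewrite -!(@cpair_splitting_core _ b) ?vproj_scale //.
by rewrite (splittingZ hL) // cpairZ ?(splitting_pB hL) ?core_lift_pB.
Qed.

(** * Fibres of a maximal isotropic double vector subbundle *)

Section MaximalIsotropic.
Context {D : set E} {U : set Q} {B' : set B}.
Context (hD : dv_subbundle V D U B') (hDmax : maximal_isotropic K B' D).
Context (hA : adapted V Sigma D U B').

Lemma dvsub_pQ e : D e -> U (pQ e).
Proof. by have [_ _ _ [_ + _]] := hD; apply. Qed.

Lemma dvsub_pB e : D e -> B' (pB e).
Proof. by have [_ _ [_ + _] _] := hD; apply. Qed.

Lemma dvsub_add e e' : pB e = pB e' -> D e -> D e' -> D (e +B e').
Proof.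
move=> p De De'; have [[_ _ hadd _] _ _] := hDmax (dvsub_pB De).
by have [] := hadd e e' (conj De erefl) (conj De' (esym p)).
Qed.

Lemma dvsub_scale a e : D e -> D (vscale (EB V) a e).
Proof.
move=> De; have [[_ _ _ hZ] _ _] := hDmax (dvsub_pB De).
by have [] := hZ a e (conj De erefl).
Qed.

Lemma dvsub_isotropic e e' : D e -> D e' -> pB e = pB e' -> cpair K e e' = 0.
Proof.
move=> De De' p; have [_ iso _] := hDmax (dvsub_pB De).
by apply: iso.
Qed.

Lemma U_fibre m : fibre_subspace (QM V) m (U `&` [set u | qM u = m]).
Proof. by have [hU _ _ _] := hD; exact: subbundle_fibre hU _. Qed.

(** Adaptedness puts the [Sigma]-part in [D], hence also the core part. Since [D] is isotropic and
    contains [Sigma u b] for u in [U], the core part annihilates [U]. *)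
Lemma dvsub_decomp e : D e -> exists2 c, annihilator K U (bM (pB e)) c &
  e = Sigma (pQ e) (pB e) +B core_lift V (pB e) c.
Proof.
move=> De; have [c cc eE] := splitting_decomp hL e; exists c => //.
set q := pQ e in eE *; set b := pB e in cc eE *.
have qb : qM q = bM b by exact: dvb_square.
have pS := splitting_pB hL qb.
have DS : D (Sigma q b) by apply: hA => //; [exact: dvsub_pQ|exact: dvsub_pB].
have Dc : D (core_lift V b c).
  rewrite (_ : core_lift V b c = e +B vscale (EB V) (-1) (Sigma q b)).
    by apply: dvsub_add => //; [rewrite vproj_scale|exact: dvsub_scale].
  by rewrite {1}eE vaddKl // core_lift_pB.
split=> // u Uu ub; rewrite -(cpair_splitting_core ub cc).
apply: dvsub_isotropic => //; first by apply: hA => //; exact: dvsub_pB.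
by rewrite core_lift_pB // (splitting_pB hL).
Qed.

(* With [q0] orthogonal to [U^o], the span of [Sigma (U + R q0)] and the lift
   of [U^o] is isotropic and contains [D], hence equals [D] by maximality. *)
Lemma dvsub_maximal b q0 c0 : B' b -> qM q0 = bM b ->
  (forall c, annihilator K U (bM b) c -> qpair K q0 c = 0) ->
  annihilator K U (bM b) c0 -> D (Sigma q0 b +B core_lift V b c0).
Proof.
move=> Bb q0b q0c ac0.
pose W := [set e | exists u a c, [/\ U u, qM u = bM b,
  annihilator K U (bM b) c &
  e = Sigma (vadd (QM V) u (vscale (QM V) a q0)) b +B core_lift V b c]].
have [_ _ maxD] := hDmax Bb.
have [Up U0 UD UZ] := U_fibre (bM b).
have DW : D `&` [set e | pB e = b] `<=` W.
  move=> e [De /= eb]; have [c ac eE] := dvsub_decomp De.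
  rewrite eb in ac eE; exists (pQ e), 0, c; split => //; first exact: dvsub_pQ.
    by rewrite dvb_square eb.
  rewrite vscale0 q0b -{1}eb -dvb_square vaddr0.
  by rewrite -eb in eE *.
have qMW u a : qM u = bM b -> qM (vadd (QM V) u (vscale (QM V) a q0)) = bM b.
  by move=> ub; rewrite vproj_add // vproj_scale ub q0b.
have WE : W `<=` D `&` [set e | pB e = b].
  apply: maxD => //; first split.
  - by move=> e [u [a [c [_ ub [cc _] ->]]]]; rewrite (splitting_sum_pB hL) ?qMW.
  - by apply: DW; have [[_ + _ _] _ _] := hDmax Bb.
  - move=> e e' [u [a [c [Uu ub ac ->]]]] [u' [a' [c' [Uu' ub' ac' ->]]]].
    exists (vadd (QM V) u u'), (a + a'), (c +B c').
    have [uu' _] := UD u u' (conj Uu ub) (conj Uu' ub').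
    split => //; first by rewrite vproj_add ?ub.
      exact: annihilatorD.
    have [[cc _] [cc' _]] := (ac, ac').
    rewrite (splitting_sumD hL) ?qMW //; congr (Sigma _ b +B _).
    by rewrite vaddACA ?vproj_scale ?vscaleDl ?ub ?ub' ?q0b.
  - move=> a e [u [a' [c [Uu ub ac ->]]]].
    exists (vscale (QM V) a u), (a * a'), (vscale (EB V) a c).
    have [au _] := UZ a u (conj Uu ub).
    split => //; first by rewrite vproj_scale.
      exact: annihilatorZ.
    have [cc _] := ac.
    rewrite (splitting_sumZ hL) ?qMW //; congr (Sigma _ b +B _).
    by rewrite vscaleDr ?vscaleA ?vproj_scale ?ub ?q0b.
  - move=> e e' [u [a [c [Uu ub ac ->]]]] [u' [a' [c' [Uu' ub' ac' ->]]]].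
    have [[cc acu] [cc' acu']] := (ac, ac').
    rewrite cpair_splitting_sum ?qMW //.
    rewrite !(@qpairD _ _ (bM b)) ?vproj_scale //.
    rewrite !(@qpairZ _ _ (bM b)) // acu' // acu // !q0c //.
    by rewrite !mulr0 !addr0.
have [] // : (D `&` [set e | pB e = b]) (Sigma q0 b +B core_lift V b c0).
apply: WE; exists (vzero (QM V) (bM b)), 1, c0; split => //.
- by have [] := U0.
- by rewrite vproj_zero.
- by rewrite vscale1 -q0b vadd0.
Qed.

Lemma annihilator0 m : annihilator K U m (vzero (EB V) (vzero (BM V) m)).
Proof.
split=> [|u Uu um].
  by split; [rewrite pQ_zeroB vproj_zero|rewrite vproj_zero].
have pz := pB_zeroQ V u; rewrite um in pz.
by rewrite /qpair (@cpair_sym _ _ _ _ K) ?vproj_zero ?pz // -pz cpair0.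
Qed.

Lemma core_lift0 b :
  core_lift V b (vzero (EB V) (vzero (BM V) (bM b))) = vzero (EB V) b.
Proof.
by rewrite /core_lift zeroB_zeroQ -pQ_zeroB vaddr0.
Qed.

(** Projecting the conclusion to Q shows that [q0] lies in [U]: the double annihilator of [U] adds
    nothing. *)
Lemma dvsub_splitting b q0 : B' b -> qM q0 = bM b ->
  (forall c, annihilator K U (bM b) c -> qpair K q0 c = 0) -> D (Sigma q0 b).
Proof.
move=> Bb q0b q0c.
have := dvsub_maximal Bb q0b q0c (annihilator0 (bM b)).
by rewrite core_lift0 -{2}(splitting_pB hL q0b) vaddr0.
Qed.

(** The case [q0] = 0 of the maximality argument: lifts of U^o can be adjoined to D(b) without
    losing isotropy. *)
Lemma dvsub_core_lift b c : B' b -> annihilator K U (bM b) c ->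
  D (core_lift V b c).
Proof.
move=> Bb ac; have [cc _] := ac.
have cE : vzero (EB V) b +B core_lift V b c = core_lift V b c.
  by rewrite -{1}(core_lift_pB cc) vadd0.
rewrite -cE -(splitting_zero hL); apply: dvsub_maximal => //.
  exact: vproj_zero.
by move=> c' [cc' _]; exact: qpair0.
Qed.

(** Pairing w with lifts of U^o shows that its Q-component kills U^o, so its [Sigma]-part is in [D];
    pairing w with [Sigma u b] then shows that its core part annihilates [U]. This reduces closure
    under the bracket to the vanishing of pairings. *)
Lemma dvsub_orthogonal w : B' (pB w) ->
  (forall e, D e -> pB e = pB w -> cpair K w e = 0) -> D w.
Proof.
move=> Bw wD; have [c cc wE] := splitting_decomp hL w.
set q := pQ w in wE; set b := pB w in Bw wD cc wE.
have qb : qM q = bM b by exact: dvb_square.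
have Dq : D (Sigma q b).
  apply: dvsub_splitting => // c' ac'; have [cc' _] := ac'.
  rewrite -(cpair_core_lift cc') wD //; first exact: dvsub_core_lift.
  exact: core_lift_pB.
rewrite wE; apply: dvsub_add => //.
  by rewrite (splitting_pB hL) // core_lift_pB.
apply: dvsub_core_lift => //; split=> // u Uu ub.
have pu := splitting_pB hL ub.
have Du : D (Sigma u b) by exact: hA.
rewrite -(cpair_splitting_core ub cc) (@cpair_sym _ _ _ _ K).
  have := wD _ Du pu; rewrite {1}wE cpairD ?(splitting_pB hL) ?core_lift_pB //.
  by rewrite cpair_splitting // add0r.
by rewrite pu core_lift_pB.
Qed.

(* Restrict a section of [D] to the zero section of [B] and subtract its
   [Sigma]-component. *)
Lemma annihilator_section m c : annihilator K U m c ->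
  exists tau, [/\ section_core V tau, tau m = c &
    forall m', annihilator K U m' (tau m')].
Proof.
move=> ac; have [cc _] := ac.
have B0 m' : B' (vzero (BM V) m').
  have [_ hB _ _] := hD.
  by have [_ [Bz _] _ _] := @subbundle_fibre _ _ _ _ _ _ m' hB I.
have Dc : D c.
  rewrite -(core_lift_zero cc); apply: dvsub_core_lift => //.
  by rewrite vproj_zero.
(* U^o is not given as a subbundle of the core, so a smooth section through c is taken from [D],
   which is a subbundle over [B']. *)
have [_ _ sD _] := hD; have [s [[ss ps] sc Ds]] := subbundle_section sD Dc.
pose s0 := s \o vzero (BM V).
have ss0 : smooth_map s0 by exact: smooth_map_comp (vzero_smooth _) ss.
have s0B m' : pB (s0 m') = vzero (BM V) m' by exact: ps.
have s0Q m' : qM (pQ (s0 m')) = bM (vzero (BM V) m').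
  by rewrite dvb_square s0B.
pose tau m' := s0 m' +B
  vscale (EB V) (-1) (Sigma (pQ (s0 m')) (vzero (BM V) m')).
have tauE m' c' : s0 m' =
    Sigma (pQ (s0 m')) (vzero (BM V) m') +B core_lift V (vzero (BM V) m') c' ->
    core V m' c' -> tau m' = c'.
  move=> sE cc'; have cb : core V (bM (vzero (BM V) m')) c' by rewrite vproj_zero.
  rewrite /tau {1}sE vaddKl; first exact: core_lift_zero.
  by rewrite (splitting_pB hL) // core_lift_pB.
have tauA m' : annihilator K U m' (tau m').
  have [c'] := dvsub_decomp (Ds _ (B0 m')).
  rewrite -/(s0 m') s0B vproj_zero => ac' /tauE ->//; by case: ac'.
exists tau; split => //; last first.
  have [c1 c2] := cc; have Ec : s0 m = c by rewrite /s0 /= -c2.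
  apply: tauE => //; rewrite Ec c1 core_lift_zero //.
  have := splitting_zero hL (vzero (BM V) m); rewrite vproj_zero => ->.
  by rewrite -{1}c2 vadd0.
split=> [|m']; last by case: (tauA m').
apply: vadd_smooth => //.
- apply: (@vscale_smooth _ _ _ (EB V) M (cst (-1))).
    by apply/smooth_atP => ?; exact: smooth_at_cst.
  have [sS _ _ _ _] := hL; apply: sS => //.
  + exact: smooth_map_comp ss0 (vproj_smooth _).
  + exact: vzero_smooth.
- by move=> m'; rewrite vproj_scale (splitting_pB hL) // s0B.
Qed.

End MaximalIsotropic.
End Splitting.
End MetricDVB.

(** * Tangency and Dirac structures *)

Section Tangent.
Context {R : realType}.
Implicit Types N : manifold R.

Lemma is_derive_unique (f : R -> R) (a b : R) :
  is_derive (0 : R) (1 : R) f a -> is_derive (0 : R) (1 : R) f b -> a = b.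
Proof. by move=> [_ <-] [_ <-]. Qed.

Lemma is_tangent0 N (x : N) v : is_tangent x v -> v (cst 0) = 0.
Proof.
move=> [lin _]; have s0 : smooth_fun (cst 0 : N -> R).
  by apply/smooth_atP => ?; exact: smooth_at_cst.
have := lin 1 (cst 0) (cst 0) s0 s0.
have -> : (fun y : N => 1 * cst 0 y + cst 0 y) = cst (0 : R).
  by apply/funext => y /=; rewrite mulr0 addr0.
by move=> ?; lra.
Qed.

Lemma smooth_fun_separation N (x y : N) :
  (forall f : N -> R, smooth_fun f -> f x = f y) -> x = y.
Proof.
move=> sep; have [n [c [ac cx]]] := atlas_cover x.
have [chi [K [schi chi1 clK Kc chi0]]] := manifold_bump ac cx.
have cy : cdom c y.
  apply: contrapT => ncy; have := sep chi schi.
  by rewrite chi1 chi0 => [/eqP|/Kc//]; rewrite oner_eq0.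
rewrite -(cmapK cx) -(cmapK cy); congr (cinv c _); apply/rowP => i.
have := sep (fun z => chi z * cmap c z 0 i); rewrite -(sep chi schi) chi1 !mul1r.
apply; apply: (bump_mul_smooth schi clK Kc chi0) => z cz.
exact: smooth_at_cmap.
Qed.

(** The definition of [velocity] does not tie v to a point. Both x and [gam 0] satisfy the Leibniz
    rule for v: on f * f this gives f x = f (gam 0), since v f is nonzero, and on f * g it then
    gives g x = g (gam 0) for all g. *)
Lemma velocity_base N (x : N) (v : (N -> R) -> R) (gam : R -> N) f :
  is_tangent x v -> velocity gam v -> smooth_fun f -> v f <> 0 -> gam 0 = x.
Proof.
move=> [_ vM] [_ vd] sf vf; symmetry; apply: smooth_fun_separation => g sg.
have dM h : smooth_fun h ->
    f x * v h + h x * v f = f (gam 0) * v h + h (gam 0) * v f.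
  move=> sh; rewrite -vM //; apply: (@is_derive_unique ((fun y => f y * h y) \o gam)).
    apply: vd; apply/smooth_atP => y.
    by apply: smooth_atM; exact: (smooth_atP _).1.
  exact: is_deriveM (vd f sf) (vd h sh).
have fE : f x = f (gam 0).
  have E := dM f sf; apply/eqP; rewrite -subr_eq0; apply/eqP.
  have : (f x - f (gam 0)) * v f = 0 by move: E; lra.
  by move=> /eqP; rewrite mulf_eq0 => /orP[/eqP//|/eqP].
have := dM g sg; rewrite fE => /addrI /mulIf; apply; exact/eqP.
Qed.

Lemma derive_zero_along (W : normedModType R) (F : W -> R) (a w : W) :
  (\forall h \near (0 : R), F (h *: w + a) = 0) -> 'D_w F a = 0.
Proof.
move=> F0; apply: lim_near_cst => //.
have Fa : F a = 0 by have := nbhs_singleton F0; rewrite scale0r add0r.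
have : \forall h \near 0^', F (h *: w + a) = 0 by exact: cvg_within F0.
by apply: filterS => h Fh /=; rewrite Fh Fa subr0 scaler0.
Qed.

(* In a chart that flattens [S], the linear functions that vanish on [S] detect
   the transverse components of the velocity [w] of [gam]. *)
Lemma velocity_tangent (B M : manifold R) (W : vbundle B M) (S : set B) b v gam f :
  subbundle W setT S -> S b -> is_tangent b v -> velocity gam v ->
  (forall l, linear_fun W l -> (forall e, S e -> l e = 0) -> v l = 0) ->
  smooth_fun f -> (forall e, S e -> f e = 0) -> v f = 0.
Proof.
(* Arguing by contradiction provides the nonzero value that forces the curve to pass through b at
   time 0. *)
move=> sS Sb tv vel vl sf f0; apply: contrapT => vf.
have g0 := velocity_base tv vel sf vf.
have [[cg sg] vd] := vel; have [_ _ loc] := sS.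
have [n [k [c [d [T [r [h ce hS]]]]]]] := loc (vproj W b) I.
have [[ac ad _] dE uT [TD TZ T0]] := h.
have db : cdom d b by rewrite (vb_chart_dom _ h).
have near_d : \forall t \near (0 : R), cdom d (gam t).
  by apply: (cg 0); rewrite g0; exact: near_dom db.
pose F := f \o cinv d; pose G := cmap d \o gam.
have dF : differentiable F (G 0).
  have [+ _] := sf _ d ad 1%N; apply; exists b => //.
  by rewrite /G /= g0.
have dG : differentiable G 0.
  by have [+ _] := sg _ d ad 1%N; apply; rewrite /= g0.
pose w := 'D_1 G 0.
have wE : v f = 'D_w F (G 0).
  have -> : v f = 'D_1 (F \o G) 0.
    have [_ <-] := vd f sf; apply: near_eq_derive.
    by apply: filterS near_d => t dt; rewrite /F /G /= cmapK.
  rewrite deriveE; last exact: differentiable_comp.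
  by rewrite diff_comp //= [in RHS]deriveE // /w deriveE.
apply: vf; rewrite wE; apply: derive_zero_along.
have w0 (i : 'I_k) : (r <= i)%N -> w 0 (rshift n i) = 0.
  move=> ri; have [chi [schi chi1 ll chi0]] := vb_chart_linear_fun i h ce.
  have Tb : T b 0 i = 0 by apply: (hS b db I).1.
  have l0 : v (fun e => chi (vproj W e) * T e 0 i) = 0.
    apply: vl => // e Se.
    have [ce'|/chi0->] := pselect (cdom c (vproj W e)); last by rewrite mul0r.
    by rewrite ((hS e _ _).1 Se) ?mulr0 // (vb_chart_dom _ h).
  (* Product rule for the cut-off coordinate along the curve: at time 0 the cutoff is 1 and the
     coordinate of b is 0, so the derivative is the component of [w]. *)
  have dchi := vd _ (smooth_fun_comp (vproj_smooth W) schi).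
  have dT : is_derive (0 : R) (1 : R) (fun t => G t 0 (rshift n i)) (w 0 (rshift n i)).
    have dG1 := diff_derivable (v := 1 : R) dG.
    rewrite /w (derive_mx dG1) mxE; apply: derivableP.
    exact: (derivable_mxP _ _ _).1.
  have dl := vd _ (let: And3 s _ _ := ll in s).
  have dM := is_deriveM dchi dT.
  have dM' := near_eq_is_derive _ dM.
  have := is_derive_unique dl (dM' _ _).
  rewrite l0 /= /G /= dE ?g0 // row_mxEr Tb chi1 scale1r => ->; last first.
    apply: filterS near_d => t dt; rewrite !fctE /= dE // row_mxEr //.
  by rewrite scale0r addr0.
(* The curve itself may leave S. It is replaced by the straight line in the chart with the same
   velocity, which stays in S because its transverse coordinates vanish. *)
have Gcont : \forall t \near (0 : R), (cmap d @` cdom d) (t *: w + G 0).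
  have ct : {for (0 : R), continuous (fun t : R => t *: w + G 0)}.
    apply: cvgD; last exact: cvg_cst.
    exact: scalel_continuous.
  apply: ct; rewrite scale0r add0r; apply: open_nbhs_nbhs; split.
    exact: cimg_open.
  by exists b => //; rewrite /G /= g0.
apply: filterS Gcont => t /cinvK[dt Et].
apply: f0; apply/hS => // i ri.
have := dE _ dt; rewrite Et => /rowP /(_ (rshift n i)); rewrite row_mxEr => <-.
rewrite !mxE w0 // mulr0 add0r /G /= g0 dE // row_mxEr.
by apply: (hS b db I).1.
Qed.

End Tangent.

(** * Anchor and bracket along the support *)

Section DiracTheory.
Context {R : realType} {E N : manifold R} {V : vbundle E N}.
Variable K : courant V.

Lemma cpair_section_smooth s s' : section V s -> section V s' ->
  smooth_fun (fun y => cpair K (s y) (s' y)).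
Proof.
by move=> [ss ps] [ss' ps']; apply: cpair_smooth => // y; rewrite ps ps'.
Qed.

(* The Leibniz rule for [[e, f e']] with [f] vanishing on [S]: the term
   [(rho(e) f) e'] lies in [D] for every section [e']. *)
Lemma dirac_anchor_tangent (S : set N) (D : set E) e x f :
  dirac_with_support K S D -> section V e -> (forall y, S y -> D (e y)) ->
  S x -> smooth_fun f -> (forall y, S y -> f y = 0) -> canchor K (e x) f = 0.
Proof.
move=> [_ sD mD brD] se De Sx sf f0; have [_ pe] := se.
(* Either e(x) is zero, and so is its anchor, or nondegeneracy yields a vector with nonzero pairing,
   through which a section [s] is chosen. *)
have [nd|] := pselect (forall e', vproj V (e x) = vproj V e' ->
    cpair K (e x) e' = 0).
  by rewrite (cpair_nondegenerate nd) canchor0.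
move=> /existsNP[e' /not_implyP[pe' ne']]; rewrite pe in pe'.
have [s ss se'] := vb_section V e'; rewrite -pe' in se'; have [_ ps] := ss.
pose F y := vscale V (f y) (s y).
have sF : section V F by exact: vscale_section.
have F0 y : S y -> F y = vzero V y by move=> Sy; rewrite /F f0 // vscale0 ps.
have DF y : S y -> D (F y).
  by move=> Sy; rewrite F0 //; have [_ [Dz _] _ _] := subbundle_fibre sD Sy.
have [_ pbr] := cbracket_section K se sF.
have [_ iso _] := mD x Sx.
have br0 : cpair K (cbracket K e F x) (e x) = 0.
  by apply: iso; split; rewrite /= ?pe ?pbr //; [exact: brD|exact: De].
have [_ pb'] := cbracket_section K se se.
(* Invariance reads rho(e)<F, e> = <[[e, F]], e> + <F, [[e, e]]>. Both terms on the right vanish at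
   x, by isotropy and by F(x) = 0, while the left side is <s, e> rho(e) f there. *)
have := cbracket_invariant K se sF se x; rewrite br0 F0 // add0r.
rewrite -{2}(pb' x) cpair0.
have -> : (fun y => cpair K (F y) (e y)) = (fun y => f y * cpair K (s y) (e y)).
  by apply/funext => y; rewrite cpairZ // ps pe.
have [_ tan _ _ _] := canchor_morphism K.
have [_ ->//] := tan (e x); last exact: cpair_section_smooth.
rewrite pe f0 // mul0r add0r => /eqP; rewrite mulf_eq0 => /orP[/eqP|/eqP//].
by rewrite se' (@cpair_sym _ _ _ _ K) ?pe -?pe'.
Qed.

Section Antisymmetry.
Context {S : set N} {D : set E}.
Context (anchor0 : forall e f, D e -> S (vproj V e) -> smooth_fun f ->
  (forall y, S y -> f y = 0) -> canchor K e f = 0).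
Context (iso : forall e e', D e -> D e' -> S (vproj V e) ->
  vproj V e = vproj V e' -> cpair K e e' = 0).

Definition Dsection e := section V e /\ forall y, S y -> D (e y).

Lemma Dsection_pair0 e e' y : Dsection e -> Dsection e' -> S y ->
  cpair K (e y) (e' y) = 0.
Proof.
move=> [[_ pe] De] [[_ pe'] De'] Sy.
by apply: iso; rewrite ?pe ?pe' //; [exact: De|exact: De'].
Qed.

(** The invariance of the pairing has left side rho(e1)<e2, e3>, which is zero since <e2, e3>
    vanishes on [S] and the anchor of [D] is tangent to [S]. *)
Lemma bracket_antisym23 e1 e2 e3 x : Dsection e1 -> Dsection e2 ->
  Dsection e3 -> S x ->
  cpair K (cbracket K e1 e2 x) (e3 x) = - cpair K (cbracket K e1 e3 x) (e2 x).
Proof.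
move=> D1 D2 D3 Sx; have [s1 d1] := D1; have [s2 d2] := D2; have [s3 d3] := D3.
have := cbracket_invariant K s1 s2 s3 x; rewrite anchor0 //; last 4 first.
- exact: d1.
- by rewrite s1.2.
- exact: cpair_section_smooth.
- by move=> y; exact: Dsection_pair0.
rewrite [cpair K (e2 x) _](@cpair_sym _ _ _ _ K); first by move=> ?; lra.
by rewrite s2.2 (cbracket_section K s1 s3).2.
Qed.

(** The symmetric part of the bracket pairs with [e3] to rho(e3)<e1, e2>, zero for the same reason
    of tangency. *)
Lemma bracket_antisym12 e1 e2 e3 x : Dsection e1 -> Dsection e2 -> D e3 ->
  vproj V e3 = x -> S x ->
  cpair K (cbracket K e1 e2 x) e3 = - cpair K (cbracket K e2 e1 x) e3.
Proof.
move=> D1 D2 D3 p3 Sx; have [s1 d1] := D1; have [s2 d2] := D2.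
have [p12 p21] := ((cbracket_section K s1 s2).2 x, (cbracket_section K s2 s1).2 x).
have sf := cpair_section_smooth s1 s2.
have := cD_pair K sf e3; rewrite p3 -cbracket_sym // cpairD ?p12 ?p21 //.
rewrite anchor0 ?p3 //; first by move=> ?; lra.
by move=> y; exact: Dsection_pair0.
Qed.

(* [<[[e1, e2]], e3>] on [S] is alternating and depends only on the values of
   the [e_i], so it vanishes if it does on generators of [D]. *)
Lemma bracket_generators (gen : set (N -> E)) :
  (forall g, gen g -> Dsection g) ->
  (forall e, D e -> S (vproj V e) -> exists g g', [/\ gen g, gen g' &
     e = vadd V (g (vproj V e)) (g' (vproj V e))]) ->
  (forall g1 g2 g3 x, gen g1 -> gen g2 -> gen g3 -> S x ->
     cpair K (cbracket K g1 g2 x) (g3 x) = 0) ->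
  forall e1 e2 x d, Dsection e1 -> Dsection e2 -> S x -> D d ->
    vproj V d = x -> cpair K (cbracket K e1 e2 x) d = 0.
Proof.
move=> genD span gen0.
have lin e1 e2 x d : Dsection e1 -> Dsection e2 -> S x ->
    (forall g, gen g -> cpair K (cbracket K e1 e2 x) (g x) = 0) ->
    D d -> vproj V d = x -> cpair K (cbracket K e1 e2 x) d = 0.
  move=> [s1 _] [s2 _] Sx g0 Dd pd.
  have [g [g' [gg gg' dE]]] := span d Dd (eq_ind_r S Sx pd).
  have [[[_ pg] _] [[_ pg'] _]] := (genD g gg, genD g' gg').
  rewrite pd in dE; rewrite dE cpairDr ?pg ?pg' ?(cbracket_section K s1 s2).2 //.
  by rewrite !g0 // addr0.
have L1 g1 g2 e x : gen g1 -> gen g2 -> Dsection e -> S x ->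
    cpair K (cbracket K g1 g2 x) (e x) = 0.
  move=> G1 G2 [[_ pe] De] Sx; apply: lin => //; try exact: genD.
  - by move=> g gg; exact: gen0.
  - exact: De.
have L2 g1 e2 e3 x : gen g1 -> Dsection e2 -> Dsection e3 -> S x ->
    cpair K (cbracket K g1 e2 x) (e3 x) = 0.
  move=> G1 D2 [[_ p3] d3] Sx; apply: lin => //; try exact: genD.
  - move=> g gg; rewrite bracket_antisym23 //; try exact: genD.
    by rewrite L1 // oppr0.
  - exact: d3.
move=> e1 e2 x d D1 D2 Sx Dd pd; apply: lin => // g gg.
have Dg := genD g gg; have [[_ pg] dg] := Dg.
rewrite bracket_antisym23 // bracket_antisym12 ?L2 ?oppr0 //; try exact: pg.
by have [_ d2] := D2; exact: d2.
by have [[_ p2] _] := D2.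
Qed.

End Antisymmetry.
End DiracTheory.

(** * Dorfman 2-representations *)

Section DorfmanDirac.
Context {R : realType} {E Q B M : manifold R}.
Context {V : dvb E Q B M} {K : courant (EB V)} {rhoQ : Q -> (M -> R) -> R}.
Context (hVB : vb_courant K rhoQ).
Context {D : set E} {U : set Q} {B' : set B}.
Context (hD : dv_subbundle V D U B') (hDmax : maximal_isotropic K B' D).
Context {Sigma : Q -> B -> E} (hS : lagrangian_splitting K Sigma).
Context (hA : adapted V Sigma D U B').
Context {dB : E -> B} {Delta : (M -> Q) -> (M -> E) -> M -> E}.
Context {nabla : (M -> Q) -> (M -> B) -> M -> B} {Rc : Q -> Q -> B -> E}.
Context {dull : (M -> Q) -> (M -> Q) -> M -> Q}.
Context (hrep : dorfman_2rep K rhoQ Sigma dB Delta nabla Rc dull).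
Local Notation pQ := (vproj (EQ V)).
Local Notation pB := (vproj (EB V)).
Local Notation qM := (vproj (QM V)).
Local Notation bM := (vproj (BM V)).
Local Notation "x +Q y" := (vadd (EQ V) x y) (at level 50, left associativity).
Local Notation "x +B y" := (vadd (EB V) x y) (at level 50, left associativity).
Let hM : metric_dvb K. Proof. by case: hVB. Qed.
Let hL := hS.1.
Let hB : subbundle (BM V) setT B'. Proof. by case: hD. Qed.
Let hU : subbundle (QM V) setT U. Proof. by case: hD. Qed.

Lemma B'_zero m : B' (vzero (BM V) m).
Proof. by have [_ [Bz _] _ _] := @subbundle_fibre _ _ _ _ _ _ m hB I. Qed.

Lemma sigmaQ_Dsection u : section (QM V) u -> (forall m, U (u m)) ->
  Dsection (V := EB V) (S := B') (D := D) (sigmaQ V Sigma u).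
Proof.
move=> su Uu; split; first exact: sigmaQ_section hL _ su.
by move=> b Bb; apply: hA => //; exact: su.2.
Qed.

Lemma dagger_Dsection tau : section_core V tau ->
  (forall m, annihilator K U m (tau m)) ->
  Dsection (V := EB V) (S := B') (D := D) (dagger V tau).
Proof.
move=> st at_; split; first exact: dagger_section.
by move=> b Bb; exact: (dvsub_core_lift hM hS hD hDmax hA).
Qed.

Lemma dB_proj m c tau : section_core V tau -> tau m = c -> bM (dB c) = m.
Proof.
move=> st <-; have [[[hdB _ _] _ _ _ _] _ _ _ _] := hrep.
by have [_ ->] := hdB tau st.
Qed.

Lemma bracket_sigmaQ u1 u2 b : section (QM V) u1 -> section (QM V) u2 ->
  let c := Rc (u1 (bM b)) (u2 (bM b)) b in
  [/\ core V (bM b) c, qM (dull u1 u2 (bM b)) = bM b &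
    cbracket K (sigmaQ V Sigma u1) (sigmaQ V Sigma u2) b =
    Sigma (dull u1 u2 (bM b)) b +B vscale (EB V) (-1) (core_lift V b c)].
Proof.
move=> s1 s2 c; have [[_ _ _ hR hdull] _ _ _ ->//] := hrep; split => //.
  by have [/(_ _ _ s1 s2) [_ + _ _] _ _ _] := hR; apply.
by have [[_ +] _] := hdull u1 u2 s1 s2; apply.
Qed.

(** * A Dirac structure satisfies the four conditions *)

Section Necessity.
Context (dirac : dirac_with_support K B' D).

(** At the zero vector over m, the anchor of the core section through c is the velocity of t |-> t
    [dB c]. A linear function vanishing on [B'] has derivative [l (dB c)] along it, and tangency
    makes this zero. *)
Lemma dirac_core_anchor m c : annihilator K U m c -> B' (dB c).
Proof.
move=> ac; apply: contrapT => nB.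
have [l [ll l0 lnz]] := subbundle_separation hB nB.
have [sl lD lZ] := ll.
have [tau [st tm at_]] := annihilator_section hM hS hD hDmax hA ac.
set b := vzero (BM V) m; have Bb : B' b by exact: B'_zero.
have bm : bM b = m by rewrite vproj_zero.
have [sd dd] := dagger_Dsection st at_.
have a0 := dirac_anchor_tangent dirac sd dd Bb sl l0.
have [_ /(_ tau st b) + _ _ _] := hrep; rewrite bm tm => -[_ /(_ l sl)].
rewrite a0.
have -> : l \o (fun t : R => vadd (BM V) b (vscale (BM V) t (dB c))) =
    cst (l b) + (fun t : R => t * l (dB c)).
  apply/funext => t; rewrite !fctE /= lD ?lZ // vproj_scale bm.
  by rewrite (dB_proj st tm).
move=> dv; apply: lnz; apply/esym; apply: is_derive_unique dv _.
have dm := is_deriveM (is_derive_id (0 : R) (1 : R))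
  (is_derive_cst (l (dB c)) (0 : R) (1 : R)).
have := is_deriveD (is_derive_cst (l b) (0 : R) (1 : R)) dm.
by rewrite /GRing.scale /= mul0r add0r mulr1 add0r.
Qed.

(** For a linear l that vanishes on [B'], the term with [l \o b] drops out, so the anchor of the
    lift of u applied to l is [- l (nabla u b m)]. *)
Lemma dirac_connection u b m : section (QM V) u -> (forall m, U (u m)) ->
  section (BM V) b -> (forall m, B' (b m)) -> B' (nabla u b m).
Proof.
move=> su Uu sb Bb; apply: contrapT => nB.
have [l [ll l0 lnz]] := subbundle_separation hB nB.
have [sl _ _] := ll; have [sd dd] := sigmaQ_Dsection su Uu.
have a0 := dirac_anchor_tangent dirac sd dd (Bb m) sl l0.
have [_ _ /(_ u su) [_ hX] _ _] := hrep.
have := hX l ll b sb m; rewrite /= a0.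
have -> : l \o b = cst 0 by apply/funext => y /=; exact: l0.
have [_ [[_ rtan _ _ _] _ _ _] _] := hVB.
rewrite (is_tangent0 (rtan (u m))) sub0r => lE.
by apply: lnz; apply/eqP; rewrite -oppr_eq0 -lE.
Qed.

Lemma dirac_bracket u1 u2 b : section (QM V) u1 -> (forall m, U (u1 m)) ->
  section (QM V) u2 -> (forall m, U (u2 m)) -> B' b ->
  D (cbracket K (sigmaQ V Sigma u1) (sigmaQ V Sigma u2) b).
Proof.
move=> s1 U1 s2 U2 Bb; have [_ _ _ hbr] := dirac.
have [[sd1 d1] [sd2 d2]] := (sigmaQ_Dsection s1 U1, sigmaQ_Dsection s2 U2).
exact: hbr.
Qed.

(** The bracket is read at the zero vector over m, which lies in [B']; its projection to Q is
    [dull u1 u2 m]. *)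
Lemma dirac_dull u1 u2 m : section (QM V) u1 -> (forall m, U (u1 m)) ->
  section (QM V) u2 -> (forall m, U (u2 m)) -> U (dull u1 u2 m).
Proof.
move=> s1 U1 s2 U2; have := dirac_bracket s1 U1 s2 U2 (B'_zero m).
have [cc dm ->] := bracket_sigmaQ (vzero (BM V) m) s1 s2.
rewrite -core_liftZ // => /(dvsub_pQ hD); rewrite (splitting_sum_pQ hL) //.
  by rewrite vproj_zero.
exact: coreZ.
Qed.

(** Pairing the bracket with [Sigma u b] removes its [Sigma]-part, because the splitting is
    Lagrangian, and leaves the curvature up to sign. *)
Lemma dirac_curvature u1 u2 b : section (QM V) u1 -> (forall m, U (u1 m)) ->
  section (QM V) u2 -> (forall m, U (u2 m)) -> B' b ->
  annihilator K U (bM b) (Rc (u1 (bM b)) (u2 (bM b)) b).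
Proof.
move=> s1 U1 s2 U2 Bb; have := dirac_bracket s1 U1 s2 U2 Bb.
have [cc dm ->] := bracket_sigmaQ b s1 s2.
set c := Rc _ _ _ in cc *; set q := dull _ _ _ in dm * => De.
have pS := splitting_pB hL dm; have pl := core_lift_pB cc.
split=> // u Uu ub; have pu := splitting_pB hL ub.
have Du : D (Sigma u b) by exact: hA.
have pe : pB (Sigma q b +B vscale (EB V) (-1) (core_lift V b c)) = b.
  by rewrite vproj_add ?vproj_scale ?pS ?pl.
have := dvsub_isotropic hD hDmax Du De; rewrite pe pu => /(_ erefl).
rewrite cpairDr ?vproj_scale ?pS ?pl ?pu // (cpair_splitting hS) //.
rewrite cpairZr ?pl ?pu // (cpair_splitting_core hM hS) // add0r => /eqP.
by rewrite mulf_eq0 oppr_eq0 oner_eq0 => /eqP.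
Qed.

End Necessity.

(** * The four conditions imply closure under the bracket *)

Section Sufficiency.
Context (hdB : forall m c, annihilator K U m c -> B' (dB c)).
Context (hnabla : forall u b, section (QM V) u -> (forall m, U (u m)) ->
  section (BM V) b -> (forall m, B' (b m)) -> forall m, B' (nabla u b m)).
Context (hdull : forall u1 u2, section (QM V) u1 -> (forall m, U (u1 m)) ->
  section (QM V) u2 -> (forall m, U (u2 m)) -> forall m, U (dull u1 u2 m)).
Context (hRc : forall u1 u2, section (QM V) u1 -> (forall m, U (u1 m)) ->
  section (QM V) u2 -> (forall m, U (u2 m)) -> forall b, B' b ->
  annihilator K U (bM b) (Rc (u1 (bM b)) (u2 (bM b)) b)).

(** The anchor is the velocity of b + t [dB c], a line that stays in [B']. *)
Lemma core_anchor_tangent b c f : B' b -> annihilator K U (bM b) c ->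
  smooth_fun f -> (forall e, B' e -> f e = 0) ->
  canchor K (core_lift V b c) f = 0.
Proof.
move=> Bb ac sf f0.
have [tau [st tm at_]] := annihilator_section hM hS hD hDmax hA ac.
have [_ /(_ tau st b) + _ _ _] := hrep; rewrite /dagger tm => -[_ /(_ f sf)].
have -> : f \o (fun t : R => vadd (BM V) b (vscale (BM V) t (dB c))) = cst 0.
  apply/funext => t /=; apply: f0.
  have [_ _ BD BZ] := @subbundle_fibre _ _ _ _ _ _ (bM b) hB I.
  have [] // := BD b (vscale (BM V) t (dB c)) (conj Bb erefl).
  apply: BZ; split; first exact: hdB ac.
  exact: dB_proj st tm.
by move=> dv; apply: is_derive_unique dv (is_derive_cst _ _ _).
Qed.

Lemma splitting_anchor_tangent u b f : B' b -> U u -> qM u = bM b ->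
  smooth_fun f -> (forall e, B' e -> f e = 0) ->
  canchor K (Sigma u b) f = 0.
Proof.
move=> Bb Uu ub sf f0.
have [su [ssu su_u Usu]] := subbundle_section hU Uu.
have [sb [ssb sb_b Bsb]] := subbundle_section hB Bb.
(* Adding [Sigma u b] to itself over Q is only a way to extract from [prolonged_add] a curve whose
   velocity is the anchor of [Sigma u b]. *)
have [_ [[_ rtan _ _ _] _ /(_ (Sigma u b) (Sigma u b) erefl) hadd _] _] := hVB.
have [c1 [c2 [_ vel _ _]]] := hadd.
have [_ tan _ _ _] := canchor_morphism K.
have tanb := tan (Sigma u b); rewrite (splitting_pB hL) // in tanb.
apply: (velocity_tangent hB Bb tanb vel) => // l ll l0.
have [_ _ /(_ su ssu) [_ hX] _ _] := hrep.
have := hX l ll sb ssb (bM b); rewrite /= sb_b /sigmaQ -ub su_u => ->.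
have -> : l \o sb = cst 0 by apply/funext => y /=; apply: l0; exact: Bsb.
rewrite l0; last by apply: hnabla => // m; [exact: Usu|exact: Bsb].
rewrite subr0; have := rtan u; exact: is_tangent0.
Qed.

Lemma dvsub_anchor_tangent e f : D e -> B' (pB e) -> smooth_fun f ->
  (forall b, B' b -> f b = 0) -> canchor K e f = 0.
Proof.
move=> De Be sf f0; have [c ac eE] := dvsub_decomp hM hS hD hDmax hA De.
have [_ _ _ hadd _] := canchor_morphism K.
have [cc _] := ac; have qb : qM (pQ e) = bM (pB e) by exact: dvb_square.
rewrite eE hadd ?(splitting_pB hL) ?core_lift_pB //.
rewrite splitting_anchor_tangent ?core_anchor_tangent ?addr0 //.
exact: (dvsub_pQ hD).
Qed.

Definition generator (g : B -> E) : Prop :=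
  (exists u, [/\ section (QM V) u, forall m, U (u m) & g = sigmaQ V Sigma u]) \/
  (exists tau, [/\ section_core V tau, forall m, annihilator K U m (tau m) &
    g = dagger V tau]).

Lemma generator_Dsection g : generator g ->
  Dsection (V := EB V) (S := B') (D := D) g.
Proof.
by move=> [[u [su Uu ->]]|[tau [st at_ ->]]];
  [exact: sigmaQ_Dsection|exact: dagger_Dsection].
Qed.

Lemma generator_span e : D e -> B' (pB e) -> exists g g',
  [/\ generator g, generator g' & e = g (pB e) +B g' (pB e)].
Proof.
move=> De Be; have [c ac eE] := dvsub_decomp hM hS hD hDmax hA De.
have [tau [st tm at_]] := annihilator_section hM hS hD hDmax hA ac.
have [u [su uq Uu]] := subbundle_section hU (dvsub_pQ hD De).
exists (sigmaQ V Sigma u), (dagger V tau); split.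
- by left; exists u; split => // m; exact: Uu.
- by right; exists tau.
- by rewrite /sigmaQ /dagger tm -dvb_square uq -/(core_lift V (pB e) c) -eE.
Qed.

Lemma bracket_sigmaQ_dvsub u1 u2 b : section (QM V) u1 -> (forall m, U (u1 m)) ->
  section (QM V) u2 -> (forall m, U (u2 m)) -> B' b ->
  D (cbracket K (sigmaQ V Sigma u1) (sigmaQ V Sigma u2) b).
Proof.
move=> s1 U1 s2 U2 Bb; have [cc dm ->] := bracket_sigmaQ b s1 s2.
apply: (dvsub_add hD hDmax).
- by rewrite vproj_scale (splitting_pB hL) // core_lift_pB.
- by apply: hA => //; exact: hdull.
- apply: (dvsub_scale hD hDmax).
  by apply: (dvsub_core_lift hM hS hD hDmax hA) => //; exact: hRc.
Qed.

Let iso e e' (De : D e) (De' : D e') (_ : B' (pB e)) (p : pB e = pB e') :=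
  dvsub_isotropic hD hDmax De De' p.

(** Brackets of two [sigmaQ] lie in [D]. For [sigmaQ] against [dagger], a third [sigmaQ] reduces to
    that case by alternation, and a third [dagger] gives a pairing of two lifted core elements. The
    order [dagger], [sigmaQ] follows by alternation, and two [dagger] have zero bracket. *)
Lemma bracket_generator g1 g2 g3 b :
  generator g1 -> generator g2 -> generator g3 -> B' b ->
  cpair K (cbracket K g1 g2 b) (g3 b) = 0.
Proof.
move=> G1 G2 G3 Bb.
have [D1 D2] := (generator_Dsection G1, generator_Dsection G2).
have D3 := generator_Dsection G3.
have [[[s1 d1] [s2 d2]] [s3 d3]] := (D1, D2, D3).
have pb g g' : section (EB V) g -> section (EB V) g' -> pB (cbracket K g g' b) = b.
  by move=> sg sg'; exact: (cbracket_section K sg sg').2.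
have anti23 := bracket_antisym23 dvsub_anchor_tangent iso.
have anti12 := bracket_antisym12 dvsub_anchor_tangent iso.
have ss u1 u2 g : section (QM V) u1 -> (forall m, U (u1 m)) ->
    section (QM V) u2 -> (forall m, U (u2 m)) -> generator g ->
    cpair K (cbracket K (sigmaQ V Sigma u1) (sigmaQ V Sigma u2) b) (g b) = 0.
  move=> su1 U1 su2 U2 /generator_Dsection[sg dg].
  apply: (dvsub_isotropic hD hDmax).
  - exact: bracket_sigmaQ_dvsub.
  - exact: dg.
  - by rewrite sg.2 pb //; exact: sigmaQ_section.
have st u tau g : section (QM V) u -> (forall m, U (u m)) ->
    section_core V tau -> (forall m, annihilator K U m (tau m)) ->
    generator g ->
    cpair K (cbracket K (sigmaQ V Sigma u) (dagger V tau) b) (g b) = 0.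
  move=> su Uu stau atau [[u' [su' Uu' ->]]|[tau' [stau' atau' ->]]].
    have Dt := dagger_Dsection stau atau.
    rewrite anti23 ?ss ?oppr0 //; try exact: sigmaQ_Dsection.
    by right; exists tau.
  have [[_ hDelta _ _ _] _ _ hst _] := hrep.
  have [_ cD] := hDelta u tau su stau.
  rewrite hst //; apply: (cpair_core_core hM); first exact: cD.
  by case: stau'.
case: G1 => [[u1 [su1 U1 E1]]|[t1 [st1 at1 E1]]];
  case: G2 => [[u2 [su2 U2 E2]]|[t2 [st2 at2 E2]]].
- by rewrite E1 E2 ss.
- by rewrite E1 E2 st.
- rewrite anti12 //; first by rewrite E1 E2 st ?oppr0.
    exact: d3.
  exact: s3.2.
- have [_ _ [_ _ hcc]] := hVB.
  rewrite hcc; try by [exists t1 => // y; rewrite E1|exists t2 => // y; rewrite E2].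
  by rewrite -{1}(s3.2 b) cpair0.
Qed.

Lemma dvsub_bracket e1 e2 b :
  Dsection (V := EB V) (S := B') (D := D) e1 ->
  Dsection (V := EB V) (S := B') (D := D) e2 -> B' b ->
  D (cbracket K e1 e2 b).
Proof.
move=> D1 D2 Bb; have pb := (cbracket_section K D1.1 D2.1).2 b.
apply: (dvsub_orthogonal hM hS hD hDmax hA); rewrite pb // => d Dd pd.
apply: (bracket_generators dvsub_anchor_tangent iso generator_Dsection) => //.
- exact: generator_span.
- by move=> g1 g2 g3 x; exact: bracket_generator.
Qed.

End Sufficiency.
End DorfmanDirac.

Theorem proposition8p5 (R : realType) (E Q B M : manifold R)
    (V : dvb E Q B M) (K : courant (EB V)) (rhoQ : Q -> (M -> R) -> R)
    (hVB : vb_courant K rhoQ)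
    (D : set E) (U : set Q) (B' : set B)
    (hD : dv_subbundle V D U B') (hDmax : maximal_isotropic K B' D)
    (Sigma : Q -> B -> E) (hSigma : lagrangian_splitting K Sigma)
    (hadapted : adapted V Sigma D U B')
    (dB : E -> B) (Delta : (M -> Q) -> (M -> E) -> M -> E)
    (nabla : (M -> Q) -> (M -> B) -> M -> B) (Rc : Q -> Q -> B -> E)
    (dull : (M -> Q) -> (M -> Q) -> M -> Q)
    (hrep : dorfman_2rep K rhoQ Sigma dB Delta nabla Rc dull) :
  dirac_with_support K B' D <->
  [/\ forall m c, annihilator K U m c -> B' (dB c),
      forall u b, section (QM V) u -> (forall m, U (u m)) ->
        section (BM V) b -> (forall m, B' (b m)) ->
        forall m, B' (nabla u b m),
      forall u1 u2, section (QM V) u1 -> (forall m, U (u1 m)) ->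
        section (QM V) u2 -> (forall m, U (u2 m)) ->
        forall m, U (dull u1 u2 m) &
      forall u1 u2, section (QM V) u1 -> (forall m, U (u1 m)) ->
        section (QM V) u2 -> (forall m, U (u2 m)) ->
        forall b, B' b ->
          annihilator K U (vproj (BM V) b)
            (Rc (u1 (vproj (BM V) b)) (u2 (vproj (BM V) b)) b)].
Proof.
split=> [dirac|[h1 h2 h3 h4]].
  split.
  - by move=> m c; exact: (dirac_core_anchor hVB hD hDmax hSigma hadapted hrep).
  - move=> u b su Uu sb Bb m.
    exact: (dirac_connection hVB hD hSigma hadapted hrep).
  - move=> u1 u2 s1 U1 s2 U2 m.
    exact: (dirac_dull hD hSigma hadapted hrep).
  - move=> u1 u2 s1 U1 s2 U2 b Bb.
    exact: (dirac_curvature hVB hD hDmax hSigma hadapted hrep).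
(* The subbundle and isotropy requirements are part of the hypotheses on [D]; only closure under the
   bracket remains. *)
have [_ _ sD _] := hD; have [subB _ _] := sD; split => //.
move=> e1 e2 s1 s2 d1 d2 b Bb.
exact: (dvsub_bracket hVB hD hDmax hSigma hadapted hrep h1 h2 h3 h4).
Qed.
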